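(* Let $u_0$ be a given $2L$-periodic function and let $u$ be the solution, $2L$-periodic in $x$, of $$\partial_t u+\partial_x\Big(\frac{u^2}{2}-\partial_x u+\mathcal{J}[u]\Big)=0\quad (x\in\mathbf{R},\ t\in(0,T)),\qquad u(0,\cdot)=u_0 .$$ Suppose $u$ is sufficiently smooth. For each $h$, let $u_h^0\in\mathcal{S}_h^r$ satisfy $\|u_h^0-u_0\|\le C_0h^{r-1}$ with $C_0$ independent of $h$, and let $u_h(t,\cdot)\in\mathcal{S}_h^r$, $t\in[0,T]$, be the semidiscrete approximation defined by $u_h(0,\cdot)=u_h^0$ and $$(u_{ht},v_h)+(u_hu_{hx},v_h)+(u_{hx},v_h')-(\mathcal{J}[u_h],v_h')=0\qquad\forall v_h\in\mathcal{S}_h^r,\ t\in(0,T).$$ Then there is a positive constant $C=C(u)$, independent of $h$, such that $$\max_{t\in[0,T]}\|u(t,\cdot)-u_h(t,\cdot)\|\le C\,h^{r-1}.$$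
   Context: Fix $L>0$, $T>0$. All functions are real-valued. For real $s\ge 0$, $H^s_{per}$ is the Sobolev space of $2L$-periodic functions on $\mathbf{R}$ of order $s$ (elements of $H^s_{loc}(\mathbf{R})$ that are $2L$-periodic), with norm $\|\cdot\|_s$ over one period; $\|\cdot\|$ and $(\cdot,\cdot)$ are the norm and inner product of $L^2(-L,L)$. Subscripts $t,x$ denote partial derivatives and prime the spatial derivative. Nonlocal operator (with the integral truncated to $(0,L)$): $\mathcal{J}[\varphi](x)=\int_0^{L}|\xi|^{-1/3}\varphi'(x-\xi)\,d\xi$. Finite element spaces: $r\ge 2$ is an integer. For a partition $-L=x_0<x_1<\dots<x_M=L$ with $h=\max_j(x_{j+1}-x_j)$, $\mathcal{S}_h^r$ is a finite-dimensional subspace of $H^1_{per}$ consisting of continuously differentiable $2L$-periodic piecewise polynomial functions of degree $r-1$. The family $(\mathcal{S}_h^r)$ is assumed to satisfy, for small $h$, $\inf_{\chi\in\mathcal{S}_h^r}\{\|v-\chi\|+h\|(v-\chi)'\|\}\le C h^s\|v\|_s$ for all $v\in H^s_{per}$, $1\le s\le r$, with $C$ independent of $h$ and $v$. ''Sufficiently smooth'' means: there is an integer $m$ depending only on $r$ such that the conclusion holds whenever $u\in C^m([0,T]\times\mathbf{R})$. *)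

(* Defs.v *)
From HB Require Import structures.
From mathcomp Require Import all_boot all_order all_algebra.
From mathcomp Require Import all_classical all_reals all_analysis.

Set Implicit Arguments.
Unset Strict Implicit.
Unset Printing Implicit Defensive.

Import Order.TTheory GRing.Theory Num.Theory.
Import numFieldNormedType.Exports.

Local Open Scope classical_set_scope.
Local Open Scope ring_scope.

Section PeriodicL2.
Context {R : realType}.
Local Notation mu := (@lebesgue_measure R).
Implicit Types (L : R) (f g : R -> R).

Definition period_cell L : set R := `[- L, L].

Definition L2norm L f : \bar R :=
  'N[mu]_2%:E[EFin \o (f \_ (period_cell L))]%E.

Definition L2inner L f g : R := \int[mu]_(x in period_cell L) (f x * g x).

(* The integrand at xi = 0 is irrelevant (powR gives 0 `^ (- 3^-1) = 0). *)
Definition nonlocalJ L (phi : R -> R) (x : R) : R :=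
  \int[mu]_(xi in `[0, L]) (`|xi| `^ (- 3^-1) * derive1 phi (x - xi)).

End PeriodicL2.

(* Periodic Sobolev spaces of real order s = k + sigma, k = truncn s,
   0 <= sigma < 1: weak derivatives up to order k in L^2_loc, and for sigma > 0
   the Sobolev-Slobodeckij seminorm of the k-th one, in its periodic form (x and
   the increment z each range over one period). Since a weak derivative is only
   determined almost everywhere, v in H^s_per is given together with a family g
   of representatives of its weak derivatives (g 0 = v). *)
Section PeriodicSobolev.
Context {R : realType}.
Local Notation mu := (@lebesgue_measure R).
Implicit Types (L s : R) (v w : R -> R) (g : nat -> R -> R).

Definition test_function (phi : R -> R) : Prop :=
  (forall n x, derivable (derive1n n phi) x 1) /\
  (exists K : R, forall x, K < `|x| -> phi x = 0).

Definition weak_derivative (n : nat) v w : Prop :=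
  forall phi, test_function phi ->
    \int[mu]_(x in [set: R]) (v x * derive1n n phi x)
    = (-1) ^+ n * \int[mu]_(x in [set: R]) (w x * phi x).

Definition slobodeckij2 L (sigma : R) w : \bar R :=
  (\int[mu]_(x in period_cell L) \int[mu]_(z in period_cell L)
     ((w (x + z) - w x) ^+ 2 / `|z| `^ (1 + 2 * sigma))%:E)%E.

Definition Hs_norm L s g : \bar R :=
  let k := Num.truncn s in
  let sigma := s - k%:R in
  ((\sum_(0 <= j < k.+1) L2norm L (g j) ^+ 2
    + (if sigma == 0%R then 0 else slobodeckij2 L sigma (g k))) `^ 2^-1)%E.

Definition Hs_per L s v g : Prop :=
  [/\ g 0%N = v,
      forall j, (j <= Num.truncn s)%N ->
        [/\ measurable_fun [set: R] (g j), periodic (g j) (2 * L)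
          & weak_derivative j v (g j)]
    & (Hs_norm L s g < +oo)%E].

End PeriodicSobolev.

(* A partition knot 0 < ... < knot ncells together with a set of functions. *)
Record fe_space (R : realType) := FeSpace {
  ncells : nat;
  knot : nat -> R;
  fe_fun :> set (R -> R) }.

Section FiniteElements.
Context {R : realType}.
Implicit Types (L s : R) (r : nat) (S : fe_space R).

Definition mesh S : R :=
  \big[Num.max/0]_(j < ncells S) (knot S j.+1 - knot S j).

Definition piecewise_poly r S (f : R -> R) : Prop :=
  forall j, (j < ncells S)%N -> exists2 p : {poly R}, (size p <= r)%N &
    forall x, knot S j <= x <= knot S j.+1 -> f x = p.[x].

Definition is_fe_space L r S : Prop :=
  [/\ [/\ knot S 0%N = - L, knot S (ncells S) = L
        & forall j, (j < ncells S)%N -> knot S j < knot S j.+1],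
      exists n (b : 'I_n -> R -> R),
        fe_fun S = [set f | exists c : 'I_n -> R,
                              f = (fun x => \sum_(i < n) c i * b i x)]
    & forall f, fe_fun S f ->
        [/\ forall x, derivable f x 1, continuous (derive1 f),
            periodic f (2 * L) & piecewise_poly r S f]].

(* g 1 is the (weak) derivative of v; s >= 1, so it belongs to the family g. *)
Definition approximation_property L r (I : Type) (S : I -> fe_space R) : Prop :=
  exists2 h0 : R, 0 < h0 & forall s : R, 1 <= s <= r%:R ->
    exists2 C : R, 0 < C &
      forall i, mesh (S i) < h0 -> forall v g, Hs_per L s v g ->
        (ereal_inf [set L2norm L (v \- chi)%R
                        + (mesh (S i))%:E * L2norm L (g 1%N \- derive1 chi)%R
                   | chi in fe_fun (S i)]
         <= (C * mesh (S i) `^ s)%:E * Hs_norm L s g)%E.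

End FiniteElements.

Section Evolution.
Context {R : realType}.
Implicit Types (L T : R) (u : R -> R -> R).

(* u in C^m([0,T] x R): the partial derivatives D i j = d_t^i d_x^j u of order
   i + j <= m exist and are continuous up to t = 0 and t = T. *)
Definition smooth_upto (m : nat) T u : Prop :=
  exists D : nat -> nat -> R -> R -> R,
  [/\ forall t x : R, 0 <= t <= T -> D 0%N 0%N t x = u t x,
      forall i j, (i + j <= m)%N ->
        {within `[0, T] `*` [set: R], continuous (fun p : R * R => D i j p.1 p.2)},
      forall i j, (i + j < m)%N -> forall t x : R, 0 < t < T ->
        is_derive t 1 (fun t' => D i j t' x) (D i.+1 j t x)
    & forall i j, (i + j < m)%N -> forall t x : R, 0 <= t <= T ->
        is_derive x 1 (D i j t) (D i j.+1 t x)].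

Definition flux L (w : R -> R) (x : R) : R :=
  w x ^+ 2 / 2 - derive1 w x + nonlocalJ L w x.

Definition is_solution L T (u0 : R -> R) u : Prop :=
  [/\ forall x, u 0 x = u0 x,
      forall t : R, 0 <= t <= T -> periodic (u t) (2 * L)
    & forall t x : R, 0 < t < T ->
        [/\ derivable (fun t' => u t' x) t 1,
            derivable (flux L (u t)) x 1
          & derive1 (fun t' => u t' x) t + derive1 (flux L (u t)) x = 0]].

Definition is_semidiscrete L T (S : fe_space R) (uh0 : R -> R) (uh : R -> R -> R)
    : Prop :=
  [/\ forall t : R, 0 <= t <= T -> fe_fun S (uh t),
      forall x, uh 0 x = uh0 x,
      forall x, {within `[0, T], continuous (fun t : R => uh t x)},
      forall t x : R, 0 < t < T -> derivable (fun t' => uh t' x) t 1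
    & forall t : R, 0 < t < T -> forall v, fe_fun S v ->
        L2inner L (fun x => derive1 (fun t' => uh t' x) t) v
        + L2inner L (fun x => uh t x * derive1 (uh t) x) v
        + L2inner L (derive1 (uh t)) (derive1 v)
        - L2inner L (nonlocalJ L (uh t)) (derive1 v) = 0].

End Evolution.

(* Main.v *)
(* Compare u_h with the H1-orthogonal (elliptic) projection w = P u of u onto
   the finite element space, rather than with an L2 projection, whose H1 error
   would need a quasi-uniform mesh. Put rho = u - w, theta = w - u_h. Since P is
   linear and independent of t, w_t = P u_t, so the approximation property bounds
   rho, rho_x and rho_t in L2 by O(h^(r-1)); on coarse meshes the same bound is
   the trivial one ||rho||_1 <= ||u||_1. Testing the difference of the two weak
   equations with theta gives
     (theta_t, theta) = (w_t - u_t, theta) + (flux u - flux u_h, theta_x),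
     flux u - flux u_h = (u + w) rho / 2 + w theta - theta^2 / 2 - rho_x - theta_x
                         + J rho + J theta,
   where (theta^2, theta_x) = 0. The term J theta is absorbed by - ||theta_x||^2
   because ||J f|| <= eps ||f_x|| + C_eps ||f||: the part of the kernel near 0 is
   small in L2 (|xi|^(-2/3) is integrable), and away from 0 one integrates by
   parts. Gronwall's inequality concludes. *)
Require Import Defs.
From HB Require Import structures.
From mathcomp Require Import all_boot all_order all_algebra.
From mathcomp Require Import all_classical all_reals all_analysis.
From mathcomp Require Import ring lra.
From mathcomp Require Import measurable_realfun.
Set Implicit Arguments.
Unset Strict Implicit.
Unset Printing Implicit Defensive.

Import Order.TTheory GRing.Theory Num.Theory.
Import numFieldNormedType.Exports.

Local Open Scope classical_set_scope.
Local Open Scope ring_scope.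

(** * Integrals of continuous functions *)

Section ContinuousIntegrals.
Context {R : realType}.
Local Notation mu := (@lebesgue_measure R).
Implicit Types (f g F : R -> R) (a b : R).

(** The discrete solution is only known to be differentiable in t at each fixed x, with values in an
    abstract finite-dimensional set, so neither the time derivative of ||theta||^2 nor the
    membership of theta_t in the space comes for free. The remedy is a basis dual to point
    evaluations: the coordinates of a finite element function are its values at finitely many
    points, and pointwise regularity in t passes to them. The Gram matrix of this basis is
    invertible, so P u is a finite formula in the moments of u, and w_t = P u_t follows by
    differentiating these moments under the integral. The flux difference is expanded about w, so
    sup bounds are used for u and w only; the one for w comes from its H1 bound through a periodic
    Agmon inequality. The same inequality, with a small weight on the derivative, controls the far
    part of J. The rate is r - 1 because the flux contains rho_x, and the weight h in the
    approximation property costs one power there. *)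

Lemma within_integrable a b f : {within `[a, b], continuous f} ->
  mu.-integrable `[a, b] (EFin \o f).
Proof.
by move=> cf; apply: continuous_compact_integrable => //; exact: segment_compact.
Qed.

Lemma continuous_integrable a b f : continuous f ->
  mu.-integrable `[a, b] (EFin \o f).
Proof.
by move=> cf; apply: within_integrable; exact: continuous_subspaceT.
Qed.

Lemma FTC_closed a b f F : a < b -> {within `[a, b], continuous f} ->
  (forall x : R, a <= x <= b -> is_derive x 1 F (f x)) ->
  \int[mu]_(x in `[a, b]) f x = F b - F a.
Proof.
move=> ab cf dF.
have cF x : a <= x <= b -> {for x, continuous F}.
  by move=> /dF dFx; apply/differentiable_continuous/derivable1_diffP; exact: ex_derive.
rewrite /Rintegral (@continuous_FTC2 _ f F)//.
- split.
  + by move=> x; rewrite in_itv/= => /andP[ax xb]; have := dF x; rewrite !ltW// => /(_ isT) [].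
  + by apply: cvg_at_right_filter; apply: cF; rewrite lexx ltW.
  + by apply: cvg_at_left_filter; apply: cF; rewrite lexx ltW.
- move=> x; rewrite in_itv/= => /andP[ax xb].
  by have := dF x; rewrite !ltW// => /(_ isT) dFx; rewrite derive1E derive_val.
Qed.

Lemma FTC_cont a b f F : a <= b -> continuous f ->
  (forall x : R, a <= x <= b -> is_derive x 1 F (f x)) ->
  \int[mu]_(x in `[a, b]) f x = F b - F a.
Proof.
rewrite le_eqVlt => /predU1P[-> _ _|ab cf dF].
  by rewrite set_itv1 Rintegral_set1 subrr.
by apply: FTC_closed => //; exact: continuous_subspaceT.
Qed.

(** The antiderivative is the integral from [- A], so its derivative is known only inside the
    window; each use takes [A] large enough to cover the points that it compares. *)
Lemma antiderivative (A : R) f : continuous f ->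
  exists F : R -> R, forall x : R, - A < x < A -> is_derive x 1 F (f x).
Proof.
move=> cf; exists (fun x => \int[mu]_(t in `[- A, x]) f t) => x /andP[Ax xA].
have [] := @continuous_FTC1_closed R f (- A) x A xA (@continuous_integrable _ _ _ cf) Ax (cf x).
by move=> df dfE; apply: DeriveDef; [exact: df|rewrite -derive1E].
Qed.

(** Mean value theorem for [G - F]. With one side zero it gives monotonicity of an antiderivative,
    and used in both directions it gives constancy. *)
Lemma is_derive_le F G (f g : R -> R) a b : a <= b ->
  (forall x : R, a <= x <= b -> is_derive x 1 F (f x)) ->
  (forall x : R, a <= x <= b -> is_derive x 1 G (g x)) ->
  (forall x, a <= x <= b -> f x <= g x) -> F b - F a <= G b - G a.
Proof.
move=> ab dF dG fg.
have dGF x : a <= x <= b -> is_derive x 1 (G - F) (g x - f x).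
  by move=> axb; have ? := dF _ axb; have ? := dG _ axb; exact: is_deriveB.
have dGF' (x : R) : x \in `]a, b[ -> is_derive x 1 (G - F) (g x - f x).
  by rewrite in_itv/= => /andP[? ?]; apply: dGF; rewrite !ltW.
have cGF : {within `[a, b], continuous (G - F)}.
  apply/continuous_in_subspaceT => x /set_mem/=; rewrite in_itv/= => axb.
  by apply/differentiable_continuous/derivable1_diffP; exact: (@ex_derive _ _ _ _ _ _ _ (dGF _ axb)).
have [c cab] := MVT_segment ab dGF' cGF.
rewrite !fctE => E; have := fg c; rewrite in_itv/= in cab; move=> /(_ cab) h.
suff : 0 <= (G b - F b) - (G a - F a) by lra.
by rewrite E mulr_ge0// subr_ge0.
Qed.

(* Discriminant of the nonnegative quadratic x |-> \int (f + x g)^2. *)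
Lemma cauchy_schwarz (D : set R) f g : measurable D ->
  mu.-integrable D (EFin \o (fun x => f x ^+ 2)) ->
  mu.-integrable D (EFin \o (fun x => g x ^+ 2)) ->
  mu.-integrable D (EFin \o (fun x => f x * g x)) ->
  (\int[mu]_(x in D) (f x * g x)) ^+ 2 <=
  (\int[mu]_(x in D) (f x ^+ 2)) * (\int[mu]_(x in D) (g x ^+ 2)).
Proof.
move=> mD if2 ig2 ifg.
set A := \int[mu]_(x in D) (f x ^+ 2); set B := \int[mu]_(x in D) (f x * g x).
set C := \int[mu]_(x in D) (g x ^+ 2).
have H s : 0 <= A + s * B + s * s / 4 * C.
  have i1 : mu.-integrable D (EFin \o (fun x => s * (f x * g x))).
    by rewrite (_ : _ \o _ = (fun x => s%:E * (f x * g x)%:E)%E)//; exact: integrableZl.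
  have i2 : mu.-integrable D (EFin \o (fun x => s * s / 4 * (g x ^+ 2))).
    by rewrite (_ : _ \o _ = (fun x => (s * s / 4)%:E * (g x ^+ 2)%:E)%E)//; exact: integrableZl.
  have i3 : mu.-integrable D (EFin \o (fun x => f x ^+ 2 + s * (f x * g x))).
    by rewrite (_ : _ \o _ = (fun x => (f x ^+ 2)%:E + (s * (f x * g x))%:E)%E)//; exact: integrableD.
  rewrite /A /B /C -RintegralZl// -RintegralZl// -RintegralD// -RintegralD//.
  apply: Rintegral_ge0 => x _.
  suff -> : f x ^+ 2 + s * (f x * g x) + s * s / 4 * g x ^+ 2 = (f x + s / 2 * g x) ^+ 2.
    exact: sqr_ge0.
  by field.
have A0 : 0 <= A by apply: Rintegral_ge0 => x _; exact: sqr_ge0.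
have C0 : 0 <= C by apply: Rintegral_ge0 => x _; exact: sqr_ge0.
(* If [C] vanishes, the expression in [H] is affine in [s], and a nonzero [B] would let
   [s = - (A + 1) / B] produce the value -1. Otherwise [s = - 2 * B / C] is the minimiser. *)
have [Cz|Cp] := eqVneq C 0.
  have [->|Bn0] := eqVneq B 0; first by rewrite expr0n/= Cz mulr0.
  have := H (- (A + 1) / B); rewrite Cz mulr0 addr0 divfK//; lra.
have := H (- 2 * B / C).
have -> : A + - 2 * B / C * B + - 2 * B / C * (- 2 * B / C) / 4 * C = (A * C - B ^+ 2) / C by field.
have C1 : 0 < C by rewrite lt_def Cp.
by rewrite pmulr_lge0 ?invr_gt0// subr_ge0.
Qed.

End ContinuousIntegrals.

(** * Periodic C1 functions *)

Section PeriodicC1.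
Context {R : realType}.
Local Notation mu := (@lebesgue_measure R).
Implicit Types (L : R) (f g : R -> R).

(** Real-valued counterpart of the extended-real [L2norm]; the two agree on continuous functions by
    [L2norm_continuous]. *)
Definition L2nrm L f : R := Num.sqrt (\int[mu]_(x in period_cell L) (f x ^+ 2)).

(** The regularity common to finite element functions and to the time slices of the solution. *)
Definition C1per L f : Prop :=
  [/\ forall x : R, derivable f x 1, continuous (derive1 f) & periodic f (2 * L)].

Lemma C1per_derive L f : C1per L f -> forall x : R, is_derive x 1 f (derive1 f x).
Proof. by move=> [df _ _] x; rewrite derive1E; exact/derivableP. Qed.

Lemma derivable_continuous f : (forall x : R, derivable f x 1) -> continuous f.
Proof. by move=> df x; apply/differentiable_continuous/derivable1_diffP. Qed.

Lemma C1per_continuous L f : C1per L f -> continuous f.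
Proof. by move=> [df _ _]; exact: derivable_continuous. Qed.

Lemma is_derive_derive1 f g : (forall x : R, is_derive x 1 f (g x)) -> derive1 f = g.
Proof. by move=> dfg; apply/funext => x; rewrite derive1E; have := dfg x => ?; rewrite derive_val. Qed.

Lemma C1per_intro L f g : (forall x : R, is_derive x 1 f (g x)) ->
  continuous g -> periodic f (2 * L) -> C1per L f.
Proof.
by move=> dfg cg pf; split; [move=> x; have [] := dfg x|rewrite (is_derive_derive1 dfg)|].
Qed.

Lemma is_derive_shift (f : R -> R) (x c d : R) : is_derive (x + c) 1 f d ->
  is_derive x 1 (fun y => f (y + c)) d.
Proof.
move=> df; have h : is_derive x 1 (fun y : R => y + c) 1.
  by apply: is_derive_eq; rewrite addr0.
by have := @is_derive1_comp _ f (fun y => y + c) x _ _ df h; rewrite mulr1.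
Qed.

Lemma is_derive_reflect (f : R -> R) (x c d : R) : is_derive (c - x) 1 f d ->
  is_derive x 1 (fun y => f (c - y)) (- d).
Proof.
move=> df; have h : is_derive x 1 (fun y : R => c - y) (-1).
  apply: is_derive_eq. lra.
by have := @is_derive1_comp _ f (fun y => c - y) x _ _ df h; rewrite mulrN1.
Qed.

Lemma is_derive_periodic (f df : R -> R) (l : R) : periodic f l ->
  (forall x : R, is_derive x 1 f (df x)) -> periodic df l.
Proof.
move=> pf dfP x; have h := is_derive_shift (dfP (x + l)).
have E : (fun y => f (y + l)) = f by apply/funext => y; exact: pf.
rewrite E in h; have h2 := dfP x.
by rewrite -(@derive_val _ _ _ _ _ _ _ h) -(@derive_val _ _ _ _ _ _ _ h2).
Qed.

Lemma C1per_derive1_periodic L f : C1per L f -> periodic (derive1 f) (2 * L).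
Proof. by move=> Cf; apply: is_derive_periodic (C1per_derive Cf); case: Cf. Qed.

Lemma C1perD L f g : C1per L f -> C1per L g ->
  C1per L (fun x => f x + g x) /\
  derive1 (fun x => f x + g x) = (fun x => derive1 f x + derive1 g x).
Proof.
move=> Cf Cg.
have d (x : R) : is_derive x 1 (fun x => f x + g x) (derive1 f x + derive1 g x).
  by have ? := C1per_derive Cf x; have ? := C1per_derive Cg x; exact: is_deriveD.
split; last exact: is_derive_derive1.
case: Cf Cg => [_ cf pf] [_ cg pg]; apply: (C1per_intro d).
  by move=> x; apply: cvgD; [exact: cf|exact: cg].
by move=> x; rewrite pf pg.
Qed.

Lemma C1perZ L f (c : R) : C1per L f ->
  C1per L (fun x => c * f x) /\ derive1 (fun x => c * f x) = (fun x => c * derive1 f x).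
Proof.
move=> Cf.
have d (x : R) : is_derive x 1 (fun x => c * f x) (c * derive1 f x).
  by have ? := C1per_derive Cf x; exact: is_deriveZ.
split; last exact: is_derive_derive1.
case: Cf => [_ cf pf]; apply: (C1per_intro d).
  by move=> x; apply: cvgMr; exact: cf.
by move=> x; rewrite pf.
Qed.

Lemma C1perB L f g : C1per L f -> C1per L g ->
  C1per L (fun x => f x - g x) /\
  derive1 (fun x => f x - g x) = (fun x => derive1 f x - derive1 g x).
Proof.
move=> Cf Cg; have [Ng dNg] := C1perZ (-1) Cg.
have [H1 H2] := C1perD Cf Ng.
have -> : (fun x => f x - g x) = (fun x => f x + -1 * g x).
  by apply/funext => x; rewrite mulN1r.
by split=> //; rewrite H2 dNg; apply/funext => x; rewrite mulN1r.
Qed.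

Lemma C1per_sum L n (c : 'I_n -> R) (b : 'I_n -> R -> R) : (forall i, C1per L (b i)) ->
  C1per L (fun x => \sum_(i < n) c i * b i x) /\
  derive1 (fun x => \sum_(i < n) c i * b i x) = (fun x => \sum_(i < n) c i * derive1 (b i) x).
Proof.
elim: n c b => [|n IH] c b Cb.
  have E (g : 'I_0 -> R -> R) : (fun x => \sum_(i < 0) c i * g i x) = (fun=> 0 : R).
    by apply/funext => x; rewrite big_ord0.
  rewrite !E; have d (x : R) : is_derive x 1 (fun=> 0 : R) (0 : R) by exact: is_derive_cst.
  split; last exact: is_derive_derive1.
  by apply: (C1per_intro d) => // x; exact: cvg_cst.
have E (g : 'I_n.+1 -> R -> R) : (fun x => \sum_(i < n.+1) c i * g i x) =
    (fun x => \sum_(i < n) c (widen_ord (leqnSn n) i) * g (widen_ord (leqnSn n) i) x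
              + c ord_max * g ord_max x).
  by apply/funext => x; rewrite big_ord_recr.
have [H1 H2] := IH (fun i => c (widen_ord (leqnSn n) i)) (fun i => b (widen_ord (leqnSn n) i))
  (fun i => Cb _).
have [H3 H4] := C1perZ (c ord_max) (Cb ord_max).
have [H5 H6] := C1perD H1 H3.
by rewrite E; split=> //; rewrite H6 H2 H4 E.
Qed.

Lemma contM f g : continuous f -> continuous g -> continuous (fun x => f x * g x).
Proof. by move=> cf cg x; apply: cvgM; [exact: cf|exact: cg]. Qed.

Lemma contD f g : continuous f -> continuous g -> continuous (fun x => f x + g x).
Proof. by move=> cf cg x; apply: cvgD; [exact: cf|exact: cg]. Qed.

Lemma contB f g : continuous f -> continuous g -> continuous (fun x => f x - g x).
Proof. by move=> cf cg x; apply: cvgB; [exact: cf|exact: cg]. Qed.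

Lemma contZ (c : R) f : continuous f -> continuous (fun x => c * f x).
Proof. by move=> cf; apply: contM => // x; exact: cvg_cst. Qed.

Lemma contX2 f : continuous f -> continuous (fun x => f x ^+ 2).
Proof. by move=> cf; have := contM cf cf. Qed.

Lemma cont_norm f : continuous f -> continuous (fun x => `|f x|).
Proof. by move=> cf x; apply: cvg_norm; exact: cf. Qed.

Lemma intD a b f g : continuous f -> continuous g ->
  \int[mu]_(x in `[a, b]) (f x + g x) = \int[mu]_(x in `[a, b]) f x + \int[mu]_(x in `[a, b]) g x.
Proof. by move=> cf cg; rewrite RintegralD//; exact: continuous_integrable. Qed.

Lemma intB a b f g : continuous f -> continuous g ->
  \int[mu]_(x in `[a, b]) (f x - g x) = \int[mu]_(x in `[a, b]) f x - \int[mu]_(x in `[a, b]) g x.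
Proof. by move=> cf cg; rewrite RintegralB//; exact: continuous_integrable. Qed.

Lemma intZ a b (c : R) f : continuous f ->
  \int[mu]_(x in `[a, b]) (c * f x) = c * \int[mu]_(x in `[a, b]) f x.
Proof. by move=> cf; rewrite RintegralZl//; exact: continuous_integrable. Qed.

Lemma int_le a b f g : continuous f -> continuous g ->
  (forall x, a <= x <= b -> f x <= g x) ->
  \int[mu]_(x in `[a, b]) f x <= \int[mu]_(x in `[a, b]) g x.
Proof.
by move=> cf cg fg; apply: le_Rintegral => //; exact: continuous_integrable.
Qed.

Lemma int_cst a b (c : R) : a <= b -> \int[mu]_(x in `[a, b]) c = c * (b - a).
Proof.
move=> ab; have := @FTC_cont R a b (fun=> c) (fun x => c * x) ab.
rewrite mulrBr; apply; first by move=> x; exact: cvg_cst.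
by move=> x _; apply: is_derive_eq; rewrite /GRing.scale/=; ring.
Qed.

Lemma int_sq_ge0 L f : 0 <= \int[mu]_(x in period_cell L) (f x ^+ 2).
Proof. by apply: Rintegral_ge0 => x _; exact: sqr_ge0. Qed.

Lemma L2nrm_ge0 L f : 0 <= L2nrm L f.
Proof. exact: sqrtr_ge0. Qed.

Lemma L2nrm_sq L f : L2nrm L f ^+ 2 = \int[mu]_(x in period_cell L) (f x ^+ 2).
Proof. by rewrite sqr_sqrtr// int_sq_ge0. Qed.

Lemma L2inner_le L f g : continuous f -> continuous g ->
  `|L2inner L f g| <= L2nrm L f * L2nrm L g.
Proof.
move=> cf cg; rewrite -(ler_pXn2r (n := 2)) ?nnegrE ?mulr_ge0 ?L2nrm_ge0//.
rewrite exprMn !L2nrm_sq real_normK ?num_real//.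
rewrite /period_cell; apply: cauchy_schwarz; first exact: measurable_itv.
- by apply: continuous_integrable; exact: contX2.
- by apply: continuous_integrable; exact: contX2.
- by apply: continuous_integrable; exact: contM.
Qed.

Lemma L2innerDl L f g h : continuous f -> continuous g -> continuous h ->
  L2inner L (fun x => f x + g x) h = L2inner L f h + L2inner L g h.
Proof.
move=> cf cg ch; rewrite /L2inner -intD; [|exact: contM..].
by apply: eq_Rintegral => x _; rewrite mulrDl.
Qed.

Lemma L2innerC L f g : L2inner L f g = L2inner L g f.
Proof. by apply: eq_Rintegral => x _; rewrite mulrC. Qed.

Lemma L2innerZl L (c : R) f h : continuous f -> continuous h ->
  L2inner L (fun x => c * f x) h = c * L2inner L f h.
Proof.
move=> cf ch; rewrite /L2inner -intZ; last exact: contM.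
by apply: eq_Rintegral => x _; rewrite mulrA.
Qed.

Lemma L2innerBl L f g h : continuous f -> continuous g -> continuous h ->
  L2inner L (fun x => f x - g x) h = L2inner L f h - L2inner L g h.
Proof.
move=> cf cg ch; rewrite /L2inner -intB; [|exact: contM..].
by apply: eq_Rintegral => x _; rewrite mulrBl.
Qed.

Lemma L2nrm_inner L f : L2nrm L f ^+ 2 = L2inner L f f.
Proof. by rewrite L2nrm_sq; apply: eq_Rintegral => x _; rewrite expr2. Qed.

Lemma L2nrmD L f g : continuous f -> continuous g ->
  L2nrm L (fun x => f x + g x) <= L2nrm L f + L2nrm L g.
Proof.
move=> cf cg; rewrite -(ler_pXn2r (n := 2)) ?nnegrE ?addr_ge0 ?L2nrm_ge0//.
rewrite L2nrm_inner L2innerDl//; last exact: contD.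
rewrite L2innerC L2innerDl// [X in _ + X]L2innerC L2innerDl//.
have := L2inner_le L cf cg; rewrite ler_norml => /andP[_].
rewrite (L2innerC L g f) -!L2nrm_inner; lra.
Qed.

Lemma L2nrmZ L (c : R) f : continuous f -> L2nrm L (fun x => c * f x) = `|c| * L2nrm L f.
Proof.
move=> cf; rewrite /L2nrm -sqrtr_sqr -sqrtrM ?sqr_ge0// -intZ; last exact: contX2.
by congr Num.sqrt; apply: eq_Rintegral => x _; rewrite exprMn.
Qed.

Lemma L2nrmB L f g : continuous f -> continuous g ->
  L2nrm L (fun x => f x - g x) <= L2nrm L f + L2nrm L g.
Proof.
move=> cf cg; have -> : (fun x => f x - g x) = (fun x => f x + -1 * g x).
  by apply/funext => x; rewrite mulN1r.
by rewrite (le_trans (L2nrmD L cf (contZ (c := -1) cg)))// L2nrmZ// normrN1 mul1r.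
Qed.

Lemma L2nrm_le_sup L f (K : R) : 0 < L -> 0 <= K -> continuous f -> (forall x, `|x| <= L -> `|f x| <= K) ->
  L2nrm L f <= Num.sqrt (2 * L) * K.
Proof.
move=> L0 K0 cf fK; rewrite /L2nrm -(ger0_norm K0) -sqrtr_sqr -sqrtrM; last by rewrite mulr_ge0// ltW.
rewrite ler_wsqrtr//.
apply: (le_trans (y := \int[mu]_(x in `[- L, L]) (K ^+ 2))).
  apply: int_le; [exact: contX2|by move=> x; exact: cvg_cst|move=> x /andP[? ?]].
  rewrite -real_normK ?num_real// lerXn2r ?nnegrE//.
  by apply: fK; rewrite ler_norml; apply/andP.
rewrite int_cst; last by lra.
by rewrite le_eqVlt; apply/orP; left; apply/eqP; ring.
Qed.

Lemma parts_periodic L f g : 0 < L -> C1per L f -> C1per L g ->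
  L2inner L (derive1 f) g = - L2inner L f (derive1 g).
Proof.
move=> L0 Cf Cg; apply/eqP; rewrite -addr_eq0; apply/eqP.
have [[_ cf' pf] [_ cg' pg]] := (Cf, Cg).
have [cf cg] := (C1per_continuous Cf, C1per_continuous Cg).
rewrite /L2inner -intD; [|exact: contM..].
have dfg (x : R) : - L <= x <= L ->
    is_derive x 1 (fun x => f x * g x) (derive1 f x * g x + f x * derive1 g x).
  move=> _; have ? := C1per_derive Cf x; have ? := C1per_derive Cg x.
  by apply: is_derive_eq; rewrite /GRing.scale/=; ring.
rewrite (FTC_cont _ _ dfg); [|by lra|by apply: contD; exact: contM].
have E : - L + 2 * L = L by ring.
by have := pf (- L); have := pg (- L); rewrite E => -> ->; rewrite subrr.
Qed.

(** For an antiderivative [F], periodicity makes [F (y + 2 * L) - F y] have derivative zero, so it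
    takes the same value at [c] and at [- L]. *)
Lemma window_integral L f (c : R) : 0 < L -> continuous f -> periodic f (2 * L) ->
  \int[mu]_(x in `[c, c + 2 * L]) f x = \int[mu]_(x in period_cell L) f x.
Proof.
move=> L0 cf pf.
have [F dF] := @antiderivative R (`|c| + 4 * L) f cf.
have dF' (x : R) : Num.min c (- L) <= x <= Num.max c (- L) + 2 * L -> is_derive x 1 F (f x).
  move=> /andP[h1 h2]; apply: dF.
  have := ler_norm c; have := lerNnormlW (lexx `|c|).
  by case: (leP c (- L)) h1 h2 => *; lra.
have d1 (x : R) : c <= x <= c + 2 * L -> is_derive x 1 F (f x).
  by move=> /andP[? ?]; apply: dF'; case: (leP c (- L)) => *; lra.
have d2 (x : R) : - L <= x <= L -> is_derive x 1 F (f x).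
  by move=> /andP[? ?]; apply: dF'; case: (leP c (- L)) => *; lra.
rewrite /period_cell (FTC_cont _ cf d1); last by lra.
rewrite (FTC_cont _ cf d2); last by lra.
have dG (x : R) : Num.min c (- L) <= x <= Num.max c (- L) ->
   is_derive x 1 (fun y => F (y + 2 * L) - F y) 0.
  move=> /andP[h1 h2].
  have e1 : is_derive (x + 2 * L) 1 F (f (x + 2 * L)) by apply: dF'; lra.
  have e2 : is_derive x 1 F (f x) by apply: dF'; lra.
  have := is_deriveB (is_derive_shift e1) e2.
  by rewrite pf subrr.
have d0 (x : R) : is_derive x 1 (fun=> 0 : R) (0 : R) by exact: is_derive_cst.
have E : - L + 2 * L = L by ring.
case: (leP c (- L)) dG => hc dG.
- have h1 := is_derive_le hc (fun x hx => dG x hx) (fun x _ => d0 x) (fun x _ => lexx 0).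
  have h2 := is_derive_le hc (fun x _ => d0 x) (fun x hx => dG x hx) (fun x _ => lexx 0).
  by move: h1 h2; rewrite /= E; lra.
- have h1 := is_derive_le (ltW hc) (fun x hx => dG x hx) (fun x _ => d0 x) (fun x _ => lexx 0).
  have h2 := is_derive_le (ltW hc) (fun x _ => d0 x) (fun x hx => dG x hx) (fun x _ => lexx 0).
  by move: h1 h2; rewrite /= E; lra.
Qed.

(** Agmon's inequality on a circle: for [y] in the period ending at [x], [f x ^+ 2 - f y ^+ 2] is at
    most the integral of 2 |f f'| over that period; averaging over [y] replaces [f y ^+ 2] by its
    mean. *)
Lemma agmon L f (x : R) : 0 < L -> C1per L f ->
  f x ^+ 2 <= L2nrm L f ^+ 2 / (2 * L) + 2 * (L2nrm L f * L2nrm L (derive1 f)).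
Proof.
move=> L0 Cf; have [df cf' pf] := Cf; have cf := C1per_continuous Cf.
have pf' := C1per_derive1_periodic Cf.
set f' := derive1 f in cf' pf' *.
pose g y := 2 * (`|f y| * `|f' y|).
have cg : continuous g by apply: contZ; apply: contM; exact: cont_norm.
have pg : periodic g (2 * L) by move=> y; rewrite /g pf pf'.
have Ig : \int[mu]_(y in period_cell L) g y <= 2 * (L2nrm L f * L2nrm L f').
  rewrite /g intZ ?ler_pM2l//; last by apply: contM; exact: cont_norm.
  have := L2inner_le L (cont_norm cf) (cont_norm cf').
  have nE h : L2nrm L (fun x => `|h x|) = L2nrm L h.
    by congr Num.sqrt; apply: eq_Rintegral => y _; rewrite real_normK ?num_real.
  by rewrite !nE; apply: le_trans; exact: ler_norm.
have hy y : x - 2 * L <= y <= x - 2 * L + 2 * L ->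
    f x ^+ 2 - \int[mu]_(y in period_cell L) g y <= f y ^+ 2.
  move=> /andP[h1 h2].
  rewrite -(window_integral (x - 2 * L) L0 cg pg).
  have [G dG] := @antiderivative R (`|x| + 2 * L + 1) g cg.
  have dG' (z : R) : x - 2 * L <= z <= x -> is_derive z 1 G (g z).
    by move=> /andP[? ?]; apply: dG; have := ler_norm x; have := lerNnormlW (lexx `|x|); lra.
  have g0 z : 0 <= g z by rewrite mulr_ge0// mulr_ge0.
  have dG2 (z : R) : x - 2 * L <= z <= x - 2 * L + 2 * L -> is_derive z 1 G (g z).
    by move=> hz; apply: dG'; lra.
  rewrite (FTC_cont _ cg dG2); last by lra.
  have hyx : y <= x by lra.
  have df2 (z : R) : is_derive z 1 (fun z => f z * f z) (2 * (f z * f' z)).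
    have ? := C1per_derive Cf z; apply: is_derive_eq.
    by rewrite /GRing.scale/= -/f'; ring.
  have h3 := is_derive_le hyx (fun z _ => df2 z) (fun z hz => dG' z ltac:(lra)).
  have {}h3 : f x * f x - f y * f y <= G x - G y.
    by apply: h3 => z _; rewrite ler_pM2l// -normrM ler_norm.
  have d0 (z : R) : is_derive z 1 (fun=> 0 : R) (0 : R) by exact: is_derive_cst.
  have h4 := is_derive_le h1 (fun z _ => d0 z) (fun z hz => dG' z ltac:(lra)) (fun z _ => g0 z).
  have -> : x - 2 * L + 2 * L = x by ring.
  rewrite !expr2; lra.
have hxx : x - 2 * L <= x - 2 * L + 2 * L by lra.
have ccst (c : R) : continuous ((fun=> c) : R -> R) by move=> y; exact: cvg_cst.
have := int_le (ccst _) (contX2 cf) hy.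
rewrite int_cst// window_integral//; last by move=> y; rewrite pf.
  2: exact: contX2.
rewrite -L2nrm_sq.
have -> : x - 2 * L + 2 * L - (x - 2 * L) = 2 * L by ring.
have L2 : 0 < 2 * L by lra.
rewrite -ler_pdivlMr//; lra.
Qed.

Lemma sup_interpolation L (eta : R) : 0 < L -> 0 < eta -> exists2 C : R, 0 < C &
  forall f x, C1per L f -> `|f x| <= eta * L2nrm L (derive1 f) + C * L2nrm L f.
Proof.
(* Squaring the right-hand side, the summand [eta^-1] produces the cross term 2 a b of the Agmon
   bound, and [(2 * L)^-1 + 1] supplies its term a^2 / (2 L), where a and b are the norms of the
   function and of its derivative. *)
move=> L0 e0; exists (eta^-1 + ((2 * L)^-1 + 1)).
  by rewrite !addr_gt0 ?invr_gt0 ?mulr_gt0.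
move=> f x Cf; have := agmon x L0 Cf.
set a := L2nrm L f; set b := L2nrm L (derive1 f).
have [a0 b0] : 0 <= a /\ 0 <= b by rewrite !L2nrm_ge0.
set i := (2 * L)^-1; have i0 : 0 < i by rewrite invr_gt0 mulr_gt0.
set j := eta^-1; have j0 : 0 < j by rewrite invr_gt0.
have ej : eta * j = 1 by rewrite mulfV// gt_eqF.
move=> h; rewrite -(ler_pXn2r (n := 2)) ?nnegrE//; last first.
  by apply: addr_ge0; apply: mulr_ge0 => //; [exact: ltW|rewrite !addr_ge0// ltW].
rewrite real_normK ?num_real//; apply: le_trans h _.
have -> : (eta * b + (j + (i + 1)) * a) ^+ 2 = (eta * b) ^+ 2 + 2 * (eta * j) * (a * b)
   + 2 * eta * (i + 1) * (a * b) + (j ^+ 2 + 2 * j * (i + 1) + i ^+ 2 + i + 1) * a ^+ 2 + a ^+ 2 * i.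
  by ring.
have ab0 : 0 <= a * b by rewrite mulr_ge0.
have h1 : 0 <= 2 * eta * (i + 1) * (a * b) by rewrite !mulr_ge0 ?addr_ge0// ltW.
have h2 : 0 <= (j ^+ 2 + 2 * j * (i + 1) + i ^+ 2 + i + 1) * a ^+ 2.
  by rewrite mulr_ge0 ?sqr_ge0// !addr_ge0 ?mulr_ge0 ?sqr_ge0 ?addr_ge0 ?ltW.
have h3 := sqr_ge0 (eta * b).
rewrite ej; lra.
Qed.

End PeriodicC1.

(** * The nonlocal operator *)

Section NonlocalOperator.
Context {R : realType}.
Local Notation mu := (@lebesgue_measure R).
Implicit Types (L : R) (f g phi : R -> R).

Definition Jker (xi : R) : R := `|xi| `^ (- 3^-1).

Lemma ker_ge0 xi : 0 <= Jker xi.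
Proof. exact: powR_ge0. Qed.

Lemma measurable_ker (D : set R) : measurable D -> measurable_fun D Jker.
Proof.
by move=> mD; apply: (@measurableT_comp _ _ _ _ _ _ (fun x : R => x `^ (- 3^-1))).
Qed.

(** This is xi^(-2/3), arranged as the derivative of 3 xi^(1/3). *)
Lemma ker_sq (xi : R) : 0 < xi -> Jker xi ^+ 2 = 3 * (3^-1 * xi `^ (3^-1 - 1)).
Proof.
move=> x0; rewrite /Jker gtr0_norm// expr2 -powRD; last by apply/implyP => _; rewrite gt_eqF.
rewrite mulrA mulfV// mul1r; congr (_ `^ _); lra.
Qed.

Lemma is_derive_ker_sq (xi : R) : 0 < xi ->
  is_derive xi 1 (fun x : R => 3 * x `^ 3^-1) (Jker xi ^+ 2).
Proof.
by move=> x0; rewrite ker_sq//; have ? := @is_derive1_powR _ 3^-1 _ x0; exact: is_deriveZ.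
Qed.

Lemma is_derive_ker (xi : R) : 0 < xi ->
  is_derive xi 1 (fun x : R => x `^ (- 3^-1)) (- 3^-1 * xi `^ (- 3^-1 - 1)).
Proof. exact: is_derive1_powR. Qed.

Lemma continuous_powR_gt0 (p xi : R) : 0 < xi -> {for xi, continuous (fun x : R => x `^ p)}.
Proof.
move=> x0; apply/differentiable_continuous/derivable1_diffP.
exact: (@ex_derive _ _ _ _ _ _ _ (@is_derive1_powR _ p _ x0)).
Qed.

Lemma within_segment_continuous (a b : R) f :
  (forall x : R, a <= x <= b -> {for x, continuous f}) -> {within `[a, b], continuous f}.
Proof.
by move=> cf; apply/continuous_in_subspaceT => x /set_mem/=; rewrite in_itv/=; exact: cf.
Qed.

Lemma continuous_ker (xi : R) : 0 < xi -> {for xi, continuous Jker}.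
Proof.
move=> x0; apply: (@continuous_comp _ _ _ (fun x : R => `|x|) (fun x : R => x `^ (- 3^-1))).
  exact: norm_continuous.
by apply: continuous_powR_gt0; rewrite normr_gt0 gt_eqF.
Qed.

(** The bound does not involve [c], which lets [c] tend to 0. *)
Lemma int_ker_sq_away (c d : R) : 0 < c -> c <= d ->
  \int[mu]_(x in `[c, d]) (Jker x ^+ 2) <= 3 * d `^ 3^-1.
Proof.
move=> c0; rewrite le_eqVlt => /predU1P[<-|cd].
  by rewrite set_itv1 Rintegral_set1 mulr_ge0 ?powR_ge0.
have dF (x : R) : c <= x <= d -> is_derive x 1 (fun x : R => 3 * x `^ 3^-1) (Jker x ^+ 2).
  by move=> /andP[cx _]; apply: is_derive_ker_sq; exact: lt_le_trans cx.
rewrite (FTC_closed cd _ dF) ?lerBlDr ?lerDl ?mulr_ge0 ?powR_ge0//.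
apply: within_segment_continuous => x /andP[cx _].
apply: cvgM; apply: continuous_ker; exact: lt_le_trans cx.
Qed.

(** The integrand is singular at 0, so []0, d]] is exhausted by the intervals [[d / n.+1, d]], and
    the uniform bound passes to the limit by monotone convergence. *)
Lemma ker_sq_le (d : R) : 0 < d ->
  (\int[mu]_(x in `[0%R, d]) (Jker x ^+ 2)%:E <= (3 * d `^ 3^-1)%:E)%E.
Proof.
move=> d0.
have mk (D : set R) : measurable D -> measurable_fun D (fun x : R => Jker x ^+ 2).
  by move=> mD; apply: measurable_funX; exact: measurable_ker.
rewrite -integral_itv_obnd_cbnd; last first.
  by apply/measurable_EFinP; exact: mk.
pose F (i : nat) : set R := `[d / i.+1%:R, d]%classic.
have FE : `]0%R, d]%classic = \bigcup_i F i.
  apply/seteqP; split => x /=.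
    rewrite in_itv/= => /andP[x0 xd].
    have [n nx] := ltr_add_invr (divr_gt0 x0 d0).
    exists n => //; rewrite /F/= in_itv/= xd andbT.
    move: nx; rewrite add0r ltr_pdivlMr// => /ltW; rewrite mulrC; exact.
  move=> [n _]; rewrite /F/= !in_itv/= => /andP[nx ->]; rewrite andbT.
  by apply: lt_le_trans nx; rewrite divr_gt0.
have ndF : nondecreasing_seq F.
  move=> m n mn; apply/subsetPset => x; rewrite /F/= !in_itv/= => /andP[h ->].
  rewrite andbT; apply: le_trans h.
  by rewrite ler_pM2l// lef_pV2 ?posrE// ler_nat.
have F0 n : 0 < d / n.+1%:R by rewrite divr_gt0.
have cv : (\int[mu]_(x in F i) (Jker x ^+ 2)%:E @[i --> \oo] -->
    \int[mu]_(x in \bigcup_i F i) (Jker x ^+ 2)%:E)%E.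
  apply: ge0_nondecreasing_set_cvg_integral => //.
  - by move=> i; exact: measurable_itv.
  - by move=> i; apply/measurable_EFinP; apply: mk; exact: measurable_itv.
  - by move=> i x _; rewrite lee_fin sqr_ge0.
rewrite FE -(cvg_lim _ cv)//; apply: lime_le; first by apply/cvg_ex; eexists; exact: cv.
near=> n; have nd : d / n.+1%:R <= d by rewrite ler_pdivrMr// ler_pMr// ler1n.
have cw : {within `[d / n.+1%:R, d], continuous (fun x => Jker x ^+ 2)}.
  apply: within_segment_continuous => x /andP[cx _].
  by apply: cvgM; apply: continuous_ker; exact: lt_le_trans cx.
rewrite -[leLHS]fineK ?lee_fin; first exact: int_ker_sq_away.
exact: integrable_fin_num (within_integrable cw).
Unshelve. all: by end_near. Qed.

Lemma integrable_ker_sq (d : R) : mu.-integrable `[0, d] (EFin \o (fun x => Jker x ^+ 2)).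
Proof.
wlog d0 : d / 0 < d.
  move=> H; have [/H//|d0] := ltP 0 d.
  apply: integrableS (H 1 ltr01) => //.
  by move=> x /=; rewrite !in_itv/= => /andP[-> /le_trans]; apply; apply: le_trans d0 ler01.
apply/integrableP; split.
  by apply/measurable_EFinP; apply: measurable_funX; exact: measurable_ker.
apply: le_lt_trans (ltry (3 * d `^ 3^-1)); apply: le_trans (ker_sq_le d0).
by rewrite le_eqVlt; apply/orP; left; apply/eqP; apply: eq_integral => x _ /=; rewrite ger0_norm// sqr_ge0.
Qed.

Lemma continuous_bounded (a b : R) f : continuous f ->
  exists2 K : R, 0 <= K & forall x, a <= x <= b -> `|f x| <= K.
Proof.
move=> cf; have [ab|ba] := leP a b; last first.
  by exists 0 => // x /andP[h1 h2]; move: (le_trans h1 h2); rewrite leNgt ba.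
have [c _ cP] := EVT_max ab (continuous_subspaceT (cont_norm cf) : {within `[a, b], continuous _}).
by exists `|f c| => // x xab; apply: cP; rewrite in_itv.
Qed.

(** Pointwise [Jker x <= 1 + Jker x ^+ 2], and the square is integrable. *)
Lemma integrable_ker (d : R) : mu.-integrable `[0, d] (EFin \o Jker).
Proof.
have h : mu.-integrable `[0, d] (EFin \o (fun x => 1 + Jker x ^+ 2)).
  apply: (@integrableD _ _ _ mu `[0, d]%classic _ (EFin \o cst 1) (EFin \o (fun x => Jker x ^+ 2))) => //.
    by apply: continuous_integrable => x; exact: cvg_cst.
  exact: integrable_ker_sq.
apply: le_integrable h => //.
- by apply/measurable_EFinP; exact: measurable_ker.
- move=> x _ /=; rewrite lee_fin !ger0_norm ?addr_ge0 ?sqr_ge0 ?ker_ge0//.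
  by have := sqr_ge0 (Jker x - 1); have := ker_ge0 x; rewrite !expr2; nra.
Qed.

Lemma integrable_ker_mul (c d : R) f : 0 <= c -> continuous f ->
  mu.-integrable `[c, d] (EFin \o (fun xi => Jker xi * f xi)).
Proof.
move=> c0 cf; have [K K0 fK] := continuous_bounded 0 d cf.
have h : mu.-integrable `[0, d] (fun x => K%:E * (EFin \o Jker) x)%E.
  by apply: integrableZl => //; exact: integrable_ker.
have h2 : mu.-integrable `[0, d] (EFin \o (fun xi => Jker xi * f xi)).
  apply: le_integrable h => //.
  - apply/measurable_EFinP; apply: measurable_funM; first exact: measurable_ker.
    exact: measurable_funTS (continuous_measurable_fun cf).
  - move=> x /=; rewrite in_itv/= => xd; rewrite lee_fin !normrM (ger0_norm K0) mulrC.
    by rewrite ler_wpM2r// fK.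
apply: integrableS h2 => //.
by move=> x /=; rewrite !in_itv/= => /andP[cx ->]; rewrite (le_trans c0 cx).
Qed.

Lemma shifted_continuous f (x : R) : continuous f -> continuous (fun xi => f (x - xi)).
Proof.
move=> cf xi; apply: continuous_comp; last exact: cf.
by apply: cvgB; [exact: cvg_cst|exact: cvg_id].
Qed.

Lemma nonlocalJB L f g : C1per L f -> C1per L g ->
  nonlocalJ L (fun x => f x - g x) = (fun x => nonlocalJ L f x - nonlocalJ L g x).
Proof.
move=> Cf Cg; apply/funext => x; rewrite /nonlocalJ (C1perB Cf Cg).2 -RintegralB//.
- by apply: eq_Rintegral => xi _; rewrite mulrBr.
- by apply: integrable_ker_mul => //; apply: shifted_continuous; case: Cf.
- by apply: integrable_ker_mul => //; apply: shifted_continuous; case: Cg.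
Qed.

(** Continuity under the integral on []x - 1, x + 1[], dominated by [K * Jker]: [K] bounds the
    derivative on [[x - 1 - L, x + 1]], which contains all the shifts y - xi. *)
Lemma nonlocalJ_continuous L f : C1per L f -> continuous (nonlocalJ L f).
Proof.
move=> Cf x; have [_ cf' _] := Cf.
have [K K0 fK] := continuous_bounded (x - 1 - L) (x + 1) cf'.
apply: (@continuity_under_integral R _ _ mu (fun y xi => Jker xi * derive1 f (y - xi)) `[0, L]
   (measurable_itv _) (x - 1) (x + 1) _ _ (fun xi => K * Jker xi)).
- by move=> y _; apply: integrable_ker_mul => //; exact: shifted_continuous.
- apply: aeW => xi _ y _; apply: cvgMr; apply: continuous_comp; last exact: cf'.
  by apply: cvgB; [exact: cvg_id|exact: cvg_cst].
- rewrite (_ : _ \o _ = (fun x => K%:E * (EFin \o Jker) x)%E)//.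
  by apply: integrableZl => //; exact: integrable_ker.
- move=> y /=; rewrite in_itv/= => /andP[y1 y2]; apply: aeW => xi /=.
  rewrite in_itv/= => /andP[xi0 xiL]; rewrite normrM ger0_norm ?ker_ge0// mulrC.
  by rewrite ler_wpM2r ?ker_ge0// fK//; apply/andP; split; lra.
- by rewrite inE/= in_itv/=; apply/andP; split; lra.
Qed.

(** Cauchy-Schwarz, the squared kernel having integral at most 3 d^(1/3) over (0, d). As [d <= L],
    the window [[x - d, x]] lies in the single period [[x - 2 * L, x]], so the other factor is at
    most the periodic norm. *)
Lemma nonlocal_near L phi (d x : R) : 0 < L -> 0 < d -> d <= L -> C1per L phi ->
  `|\int[mu]_(xi in `[0, d]) (Jker xi * derive1 phi (x - xi))| <=
  Num.sqrt (3 * d `^ 3^-1) * L2nrm L (derive1 phi).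
Proof.
move=> L0 d0 dL Cf; have [_ cf' _] := Cf; have pf' := C1per_derive1_periodic Cf.
have cs := shifted_continuous (x := x) cf'.
have := cauchy_schwarz (D := `[0, d]) (f := Jker) (g := fun xi => derive1 phi (x - xi)) (measurable_itv _)
   (integrable_ker_sq d) (continuous_integrable _ _ (contX2 cs)) (integrable_ker_mul _ (lexx 0) cs).
set B := \int[mu]_(_ in _) _ => h.
rewrite -(ler_pXn2r (n := 2)) ?nnegrE ?mulr_ge0 ?L2nrm_ge0 ?sqrtr_ge0//.
rewrite real_normK ?num_real// exprMn sqr_sqrtr ?mulr_ge0 ?powR_ge0// L2nrm_sq.
apply: le_trans h _; apply: ler_pM.
- by apply: Rintegral_ge0 => y _; exact: sqr_ge0.
- by apply: Rintegral_ge0 => y _; exact: sqr_ge0.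
- rewrite -lee_fin; apply: le_trans (ker_sq_le d0).
  by rewrite fineK// integrable_fin_num//; exact: integrable_ker_sq.
have [G dG] := @antiderivative R (`|x| + 2 * L + 1) (fun y => derive1 phi y ^+ 2) (contX2 cf').
have dG' (z : R) : x - 2 * L <= z <= x -> is_derive z 1 G (derive1 phi z ^+ 2).
  by move=> /andP[? ?]; apply: dG; have := ler_norm x; have := lerNnormlW (lexx `|x|); lra.
have dH (xi : R) : 0 <= xi <= d -> is_derive xi 1 (fun xi => - G (x - xi)) (derive1 phi (x - xi) ^+ 2).
  move=> h; have dGx := is_derive_reflect (dG' (x - xi) ltac:(lra)).
  by rewrite -[X in is_derive _ _ _ X]opprK; exact: is_deriveN.
rewrite (FTC_cont (ltW d0) (contX2 cs) dH).
rewrite -(window_integral (x - 2 * L) L0 (contX2 cf')); last by move=> y; rewrite pf'.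
have E : x - 2 * L + 2 * L = x by ring.
have dG2 (z : R) : x - 2 * L <= z <= x - 2 * L + 2 * L -> is_derive z 1 G (derive1 phi z ^+ 2).
  by move=> hz; apply: dG'; lra.
rewrite (FTC_cont _ (contX2 cf') dG2); last by lra.
rewrite E subr0 opprK.
have h1 : x - 2 * L <= x - d by lra.
have d0' (z : R) : is_derive z 1 (fun=> 0 : R) (0 : R) by exact: is_derive_cst.
have := is_derive_le h1 (fun z _ => d0' z) (fun z hz => dG' z ltac:(lra)) (fun z _ => sqr_ge0 _).
lra.
Qed.

(* Integration by parts without integrating the derivative of [Jker]: since
   [Jker] decreases and [|phi| <= S], the derivatives of
   [Jker * (S - phi (x - .))] and of [- Jker * (S + phi (x - .))] bound the
   integrand from below and from above. *)
Lemma nonlocal_far L phi (d S x : R) : 0 < d -> d < L -> C1per L phi ->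
  (forall y, `|phi y| <= S) ->
  `|\int[mu]_(xi in `[d, L]) (Jker xi * derive1 phi (x - xi))| <= 2 * Jker d * S.
Proof.
move=> d0 dL Cf fS; have [_ cf' _] := Cf; have cs := shifted_continuous (x := x) cf'.
have cphi := C1per_continuous Cf.
pose k' (xi : R) := - 3^-1 * xi `^ (- 3^-1 - 1).
have kE (xi : R) : d <= xi <= L -> Jker xi = xi `^ (- 3^-1).
  by move=> /andP[h _]; rewrite /Jker gtr0_norm//; exact: lt_le_trans h.
have main (s : R) : `|s| = S ->
    \int[mu]_(xi in `[d, L]) (k' xi * (s - phi (x - xi)) + xi `^ (- 3^-1) * derive1 phi (x - xi))
    = Jker L * (s - phi (x - L)) - Jker d * (s - phi (x - d)).
  move=> sS; rewrite !kE ?lexx ?ltW//.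
  apply: (@FTC_closed R d L _ (fun xi => xi `^ (- 3^-1) * (s - phi (x - xi)))) => //.
    apply: within_segment_continuous => xi /andP[h _].
    have xi0 : 0 < xi by exact: lt_le_trans h.
    apply: cvgD; apply: cvgM.
    - by apply: cvgMr; exact: continuous_powR_gt0.
    - by apply: cvgB; [exact: cvg_cst|exact: shifted_continuous].
    - exact: continuous_powR_gt0.
    - exact: cs.
  move=> xi /andP[h _]; have xi0 : 0 < xi by exact: lt_le_trans h.
  have d1 := is_derive_ker xi0.
  have d2 := is_derive_reflect (C1per_derive Cf (x - xi)).
  have d3 : is_derive xi 1 (fun xi => s - phi (x - xi)) (derive1 phi (x - xi)).
    by apply: is_derive_eq; ring.
  apply: is_derive_eq; rewrite /GRing.scale/= /k'; ring.
have k'0 xi : k' xi <= 0 by rewrite /k' mulNr oppr_le0 mulr_ge0 ?powR_ge0.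
have S0 : 0 <= S by apply: le_trans (fS 0).
have icont (s : R) : mu.-integrable `[d, L] (EFin \o (fun xi =>
    k' xi * (s - phi (x - xi)) + xi `^ (- 3^-1) * derive1 phi (x - xi))).
  apply: within_integrable; apply: within_segment_continuous => xi /andP[h _].
  have xi0 : 0 < xi by exact: lt_le_trans h.
  apply: cvgD; apply: cvgM.
  - by apply: cvgMr; exact: continuous_powR_gt0.
  - by apply: cvgB; [exact: cvg_cst|exact: shifted_continuous].
  - exact: continuous_powR_gt0.
  - exact: cs.
have ik := integrable_ker_mul L (ltW d0) cs.
have h1 := main S (ger0_norm S0).
have h2 := main (- S); rewrite normrN (ger0_norm S0) in h2; move/(_ erefl) in h2.
have kd := ker_ge0 d; have kL := ker_ge0 L.
have b1 y : 0 <= S - phi y <= 2 * S.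
  by have := fS y; rewrite ler_norml => /andP[? ?]; apply/andP; split; lra.
have b2 y : - 2 * S <= - S - phi y <= 0.
  by have := fS y; rewrite ler_norml => /andP[? ?]; apply/andP; split; lra.
rewrite ler_norml; apply/andP; split.
- apply: (@le_trans _ _ (Jker L * (S - phi (x - L)) - Jker d * (S - phi (x - d)))).
    have := b1 (x - L); have := b1 (x - d) => /andP[p1 p2] /andP[p3 p4].
    have := mulr_ge0 kL p3; have := ler_wpM2l kd p2; lra.
  rewrite -h1; apply: le_Rintegral => // xi; rewrite /= in_itv/= => hx.
  rewrite kE// gerDr; have /andP[p _] := b1 (x - xi).
  by rewrite mulr_le0_ge0.
- apply: (@le_trans _ _ (Jker L * (- S - phi (x - L)) - Jker d * (- S - phi (x - d)))); last first.
    have := b2 (x - L); have := b2 (x - d) => /andP[p1 p2] /andP[p3 p4].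
    have := mulr_ge0_le0 kL p4; have := ler_wpM2l kd p1; lra.
  rewrite -h2; apply: le_Rintegral => // xi; rewrite /= in_itv/= => hx.
  rewrite kE// lerDr; have /andP[_ p] := b2 (x - xi).
  by rewrite mulr_le0.
Qed.

Lemma nonlocal_split L phi (d x : R) : 0 < d -> d < L -> C1per L phi ->
  nonlocalJ L phi x = \int[mu]_(xi in `[0, d]) (Jker xi * derive1 phi (x - xi))
    + \int[mu]_(xi in `[d, L]) (Jker xi * derive1 phi (x - xi)).
Proof.
move=> d0 dL Cf; have [_ cf' _] := Cf; have cs := shifted_continuous (x := x) cf'.
have ik := integrable_ker_mul L (lexx 0) cs.
have := @Rintegral_itvB R _ (BLeft 0) (BRight L) d ik.
rewrite !bnd_simp => /(_ (ltW d0) (ltW dL)) h.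
rewrite -Rintegral_itv_obnd_cbnd; last first.
  apply: integrableS (integrable_ker_mul L (ltW d0) cs) => //.
  by apply: subset_itvr; rewrite bnd_simp.
by rewrite -h addrC subrK.
Qed.

(** Near 0 the smallness of the kernel gives eta / 2. Far away the sup norm of [phi] is interpolated
    with a weight small enough to compensate the factor [2 * Jker d], which is large when [d] is
    small; hence [d] is fixed before that weight. *)
Lemma nonlocal_sup L (eta : R) : 0 < L -> 0 < eta -> exists2 C : R, 0 < C &
  forall phi x, C1per L phi ->
    `|nonlocalJ L phi x| <= eta * L2nrm L (derive1 phi) + C * L2nrm L phi.
Proof.
move=> L0 e0.
have [d [d0 dL hd]] : exists d : R, [/\ 0 < d, d < L & Num.sqrt (3 * d `^ 3^-1) <= eta / 2].
  pose e := (eta / 2) ^+ 2 / 3.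
  have e1 : 0 < e by rewrite divr_gt0// exprn_gt0// divr_gt0.
  (* The requirement sqrt (3 d^(1/3)) <= eta / 2 amounts to d <= e^3; the minimum with [L / 2] keeps
     the cut inside the interval. *)
  pose d := Num.min (L / 2) (e ^+ 3).
  have dd : 0 < d by rewrite lt_min divr_gt0// exprn_gt0.
  exists d; split => //.
    by rewrite gt_min; apply/orP; left; lra.
  rewrite -(ger0_norm (ltW (divr_gt0 e0 _)))// -sqrtr_sqr ler_wsqrtr//.
  rewrite -ler_pdivlMl// mulrC -/e.
  have -> : e = (e ^+ 3) `^ 3^-1 by rewrite -powR_mulrn ?ltW// -powRrM mulfV// powRr1// ltW.
  apply: ge0_ler_powR; rewrite ?invr_ge0//.
  - by rewrite nnegrE ltW.
  - by rewrite nnegrE exprn_ge0// ltW.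
  - by rewrite /d ge_min lexx orbT.
pose k := 2 * Jker d + 1.
have k0 : 0 < k by have := ker_ge0 d; rewrite /k; lra.
have ek0 : 0 < eta / 2 / k by rewrite !divr_gt0.
have [C C0 hC] := sup_interpolation L0 ek0.
exists (k * C); first by rewrite mulr_gt0.
move=> phi x Cf; rewrite (nonlocal_split _ d0 dL Cf).
apply: le_trans (ler_normD _ _) _.
have h1 := nonlocal_near x L0 d0 (ltW dL) Cf.
have h2 := nonlocal_far x d0 dL Cf (fun y => hC phi y Cf).
set a := L2nrm L phi in h2 *; set b := L2nrm L (derive1 phi) in h1 h2 *.
have a0 : 0 <= a by exact: L2nrm_ge0. have b0 : 0 <= b by exact: L2nrm_ge0.
have h3 : Num.sqrt (3 * d `^ 3^-1) * b <= eta / 2 * b by rewrite ler_wpM2r.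
have h4 : 2 * Jker d * (eta / 2 / k * b + C * a) <= k * (eta / 2 / k * b + C * a).
  rewrite ler_wpM2r//; last by rewrite /k; lra.
  by rewrite addr_ge0// mulr_ge0// ltW// !divr_gt0.
have h5 : k * (eta / 2 / k * b + C * a) = eta / 2 * b + k * C * a.
  by field; rewrite gt_eqF.
lra.
Qed.

End NonlocalOperator.

(** * Nodal bases and the H1 projection *)

Section NodalBasis.
Context {R : realType}.
Implicit Types (f g : R -> R).

Definition lincomb n (c : 'I_n -> R) (b : 'I_n -> R -> R) : R -> R :=
  fun x => \sum_(i < n) c i * b i x.

(** A linear subspace of functions; finite dimension is recorded separately by a spanning family. *)
Definition spans (S : set (R -> R)) : Prop :=
  [/\ S (fun=> 0), forall f g, S f -> S g -> S (fun x => f x + g x)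
    & forall (c : R) f, S f -> S (fun x => c * f x)].

Lemma spans_lincomb n (b : 'I_n -> R -> R) :
  spans [set f | exists c, f = lincomb c b].
Proof.
split.
- by exists (fun=> 0); apply/funext => x; rewrite /lincomb big1// => i _; rewrite mul0r.
- move=> _ _ [c ->] [d ->]; exists (fun i => c i + d i); apply/funext => x.
  by rewrite /lincomb -big_split/=; apply: eq_bigr => i _; rewrite mulrDl.
- move=> a _ [c ->]; exists (fun i => a * c i); apply/funext => x.
  by rewrite /lincomb mulr_sumr; apply: eq_bigr => i _; rewrite mulrA.
Qed.

Lemma spans_sub S f g : spans S -> S f -> S g -> S (fun x => f x - g x).
Proof.
move=> [_ SD SZ] Sf Sg; have := SD _ _ Sf (SZ (-1) _ Sg).
by congr (S _); apply/funext => x; rewrite mulN1r.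
Qed.

Lemma spans_sum S n (c : 'I_n -> R) (b : 'I_n -> R -> R) : spans S ->
  (forall i, S (b i)) -> S (lincomb c b).
Proof.
move=> [S0 SD SZ]; elim: n c b => [|n IH] c b Sb.
  by have -> : lincomb c b = (fun=> 0) by apply/funext => x; rewrite /lincomb big_ord0.
have -> : lincomb c b = (fun x => c ord0 * b ord0 x
    + lincomb (fun i => c (lift ord0 i)) (fun i => b (lift ord0 i)) x).
  by apply/funext => x; rewrite /lincomb big_ord_recl.
by apply: SD; [exact: SZ|apply: IH].
Qed.

(** The family [b] may be dependent. By induction, each new function is reduced by its interpolant
    at the nodes found so far; either the remainder vanishes identically, or it is nonzero at some
    [y], which becomes a new node after normalisation. The last clause makes the values at [p] the
    coordinates, the form needed to differentiate in time. *)
Lemma nodal_basis n (b : 'I_n -> R -> R) :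
  exists m (p : 'I_m -> R) (e : 'I_m -> R -> R),
  [/\ forall i j, e i (p j) = (i == j)%:R,
      forall i, exists c, e i = lincomb c b
    & forall c x, lincomb c b x = \sum_(i < m) lincomb c b (p i) * e i x].
Proof.
elim: n b => [|n IH] b.
  exists 0%N, (fun=> 0), (fun _ _ => 0); split; [by case|by case|].
  by move=> c x; rewrite /lincomb !big_ord0.
have [m [p [e [ep eS eR]]]] := IH (fun i => b (lift ord0 i)).
set f0 := b ord0.
have bS := spans_lincomb b; set S := [set f | _] in bS.
have bE c : lincomb c b = (fun x => c ord0 * f0 x
    + lincomb (fun i => c (lift ord0 i)) (fun i => b (lift ord0 i)) x).
  by apply/funext => x; rewrite /lincomb big_ord_recl.
have eS' i : S (e i).
  have [c ->] := eS i; exists (fun i => oapp c 0 (unlift ord0 i)); rewrite bE.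
  apply/funext => x; rewrite unlift_none/= mul0r add0r.
  by apply: eq_bigr => j _; rewrite liftK.
have f0S : S f0.
  exists (fun i => (i == ord0)%:R); rewrite bE; apply/funext => x.
  by rewrite eqxx mul1r {1}/lincomb big1 ?addr0// => j _; rewrite mul0r.
pose g x := f0 x - \sum_(i < m) f0 (p i) * e i x.
have gS : S g by apply: spans_sub => //; apply: spans_sum.
have [[y gy]|g0] := pselect (exists y, g y != 0); last first.
  exists m, p, e; split => // c x; rewrite bE eR.
  have f0E z : f0 z = \sum_(i < m) f0 (p i) * e i z.
    have : g z = 0 by apply: contrapT => gz; apply: g0; exists z; apply/eqP.
    by move=> /eqP; rewrite subr_eq0 => /eqP.
  rewrite [X in c ord0 * X]f0E mulr_sumr -big_split/=.
  by apply: eq_bigr => i _; rewrite mulrDl mulrA.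
pose q x := (g y)^-1 * g x.
have qy : q y = 1 by rewrite /q mulVf.
have gp k : g (p k) = 0.
  rewrite /g (bigD1 k)//= ep eqxx mulr1 big1 ?addr0 ?subrr// => i ik.
  by rewrite ep (negbTE ik) mulr0.
have qp k : q (p k) = 0 by rewrite /q gp mulr0.
(* [q] vanishes at the old nodes and equals 1 at [y], so subtracting [e j y * q] cancels the value
   of [e j] at [y] without disturbing the others. *)
exists m.+1, (fun i => oapp p y (unlift ord0 i)),
  (fun i => oapp (fun j x => e j x - e j y * q x) q (unlift ord0 i)); split.
- move=> i j; case: (unliftP ord0 i) => [i' ->|->]; case: (unliftP ord0 j) => [j' ->|->] /=.
  + by rewrite qp mulr0 subr0 ep (inj_eq lift_inj).
  + by rewrite qy mulr1 subrr.
  + by rewrite qp.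
  + by rewrite qy.
- have [_ _ SZ] := bS; have qS : S q by exact: SZ.
  move=> i; case: (unliftP ord0 i) => [i' _|_] //=.
  exact: (spans_sub bS (eS' _) (SZ _ _ qS)).
- move=> c x; set f := lincomb c b.
  rewrite big_ord_recl/= unlift_none/=.
  under eq_bigr do rewrite !liftK/=.
  have fE z : f z = \sum_(i < m) f (p i) * e i z + c ord0 * g y * q z.
    have -> : c ord0 * g y * q z = c ord0 * g z by rewrite /q; field.
    rewrite /g; under [X in _ = X + _]eq_bigr do rewrite {1}/f bE mulrDl -mulrA.
    by rewrite big_split/= -mulr_sumr {1}/f bE {1}eR; ring.
  have := fE y; rewrite qy mulr1 => fy.
  rewrite {1}fE fy.
  have -> : \sum_(i < m) f (p i) * (e i x - e i y * q x) =
     \sum_(i < m) f (p i) * e i x - (\sum_(i < m) f (p i) * e i y) * q x.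
    by rewrite mulr_suml -sumrB; apply: eq_bigr => i _; ring.
  ring.
Qed.

End NodalBasis.

Section H1Projection.
Context {R : realType}.
Implicit Types (L : R) (f g u v : R -> R).

Definition H1inner L f g : R := L2inner L f g + L2inner L (derive1 f) (derive1 g).

Lemma H1innerC L f g : H1inner L f g = H1inner L g f.
Proof. by rewrite /H1inner (L2innerC L f g) (L2innerC L (derive1 f)). Qed.

Lemma H1innerD L f g h : C1per L f -> C1per L g -> C1per L h ->
  H1inner L (fun x => f x + g x) h = H1inner L f h + H1inner L g h.
Proof.
move=> Cf Cg Ch; rewrite /H1inner (C1perD Cf Cg).2.
have [[_ cf' _] [_ cg' _] [_ ch' _]] := And3 Cf Cg Ch.
have [cf cg ch] := And3 (C1per_continuous Cf) (C1per_continuous Cg) (C1per_continuous Ch).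
by rewrite (L2innerDl L cf cg ch) (L2innerDl L cf' cg' ch') addrACA.
Qed.

Lemma H1innerZ L (c : R) f h : C1per L f -> C1per L h ->
  H1inner L (fun x => c * f x) h = c * H1inner L f h.
Proof.
move=> Cf Ch; rewrite /H1inner (C1perZ c Cf).2.
have [[_ cf' _] [_ ch' _]] := (Cf, Ch).
have [cf ch] := (C1per_continuous Cf, C1per_continuous Ch).
by rewrite (L2innerZl L c cf ch) (L2innerZl L c cf' ch') mulrDr.
Qed.

Lemma H1innerB L f g h : C1per L f -> C1per L g -> C1per L h ->
  H1inner L (fun x => f x - g x) h = H1inner L f h - H1inner L g h.
Proof.
move=> Cf Cg Ch; have CN := (C1perZ (-1) Cg).1.
have -> : (fun x => f x - g x) = (fun x => f x + -1 * g x).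
  by apply/funext => x; rewrite mulN1r.
by rewrite (H1innerD Cf CN Ch) (H1innerZ (-1) Cg Ch) mulN1r.
Qed.

Lemma H1inner_self L f : H1inner L f f = L2nrm L f ^+ 2 + L2nrm L (derive1 f) ^+ 2.
Proof. by rewrite /H1inner !L2nrm_inner. Qed.

Lemma H1inner_le L f g : C1per L f -> C1per L g ->
  H1inner L f g <= L2nrm L f * L2nrm L g + L2nrm L (derive1 f) * L2nrm L (derive1 g).
Proof.
move=> Cf Cg; have [[_ cf' _] [_ cg' _]] := (Cf, Cg).
have [cf cg] := (C1per_continuous Cf, C1per_continuous Cg).
rewrite /H1inner; apply: lerD.
- exact: le_trans (ler_norm _) (L2inner_le L cf cg).
- exact: le_trans (ler_norm _) (L2inner_le L cf' cg').
Qed.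

Lemma H1inner_lincomb L n (c : 'I_n -> R) (b : 'I_n -> R -> R) g :
  (forall i, C1per L (b i)) -> C1per L g ->
  H1inner L (lincomb c b) g = \sum_(i < n) c i * H1inner L (b i) g.
Proof.
move=> Cb Cg; elim: n c b Cb => [|n IH] c b Cb.
  rewrite big_ord0 -[RHS](mul0r (H1inner L g g)) -(H1innerZ 0 Cg Cg).
  by congr H1inner; apply/funext => x; rewrite /lincomb big_ord0 mul0r.
rewrite big_ord_recl -(IH _ _ (fun i => Cb (lift ord0 i))) -(H1innerZ (c ord0) (Cb ord0) Cg).
have C1 := (C1perZ (c ord0) (Cb ord0)).1.
have C2 := (C1per_sum (fun i => c (lift ord0 i)) (fun i => Cb (lift ord0 i))).1.
rewrite -(H1innerD C1 C2 Cg).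
by congr H1inner; apply/funext => x; rewrite /lincomb big_ord_recl.
Qed.

Lemma L2nrm_eq0 L f x : 0 < L -> C1per L f -> L2nrm L f = 0 -> f x = 0.
Proof.
move=> L0 Cf f0; have := agmon x L0 Cf; rewrite f0 expr0n/= mul0r mul0r mulr0 addr0.
by move=> h; apply/eqP; rewrite -sqrf_eq0 eq_le h sqr_ge0.
Qed.

(** A vector [v] in the left kernel gives a combination of zero H1 norm, which vanishes identically
    by [L2nrm_eq0]; its value at [p i] is the i-th entry of [v]. *)
Lemma gram_unit L m (p : 'I_m -> R) (e : 'I_m -> R -> R) : 0 < L ->
  (forall i j, e i (p j) = (i == j)%:R) -> (forall i, C1per L (e i)) ->
  (\matrix_(i, j) H1inner L (e i) (e j)) \in unitmx.
Proof.
move=> L0 ep Ce; rewrite -row_free_unit -kermx_eq0; set G := \matrix_(_, _) _.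
apply/eqP/row_matrixP => k; rewrite row0; set v := row k _.
have vG : v *m G = 0 by apply/sub_kermxP; exact: row_sub.
have Cv : C1per L (lincomb (v ord0) e) by exact: (C1per_sum _ _).1.
have : H1inner L (lincomb (v ord0) e) (lincomb (v ord0) e) = 0.
  rewrite H1inner_lincomb// big1// => i _; rewrite H1innerC H1inner_lincomb//.
  have h : (v *m G) ord0 i = 0 by rewrite vG mxE.
  rewrite (_ : \sum_(j < m) v ord0 j * H1inner L (e j) (e i) = (v *m G) ord0 i).
    by rewrite h mulr0.
  by rewrite [RHS]mxE; apply: eq_bigr => j _; rewrite [G j i]mxE.
rewrite H1inner_self => /eqP; rewrite paddr_eq0 ?sqr_ge0// => /andP[/eqP].
move=> /eqP; rewrite sqrf_eq0 => /eqP f0 _.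
apply/rowP => i; rewrite [RHS]mxE -(L2nrm_eq0 (p i) L0 Cv f0) /lincomb (bigD1 i)//= ep eqxx mulr1.
by rewrite big1 ?addr0// => j ji; rewrite ep (negbTE ji) mulr0.
Qed.

(* [H] is the inverse of the Gram matrix of the nodal basis [e]. *)
Definition h1proj L m (H : 'M[R]_m) (e : 'I_m -> R -> R) (u : R -> R) : R -> R :=
  lincomb (fun i => \sum_(j < m) H1inner L u (e j) * H j i) e.

(** By linearity, orthogonality is tested on each [e k], where it reads [rv *m invmx G *m G = rv]
    for the row [rv] of moments of [u]. The matrix depends on the space alone, so in time only the
    moments vary. *)
Lemma fe_space_basis L r (S : fe_space R) : 0 < L -> is_fe_space L r S ->
  exists m (p : 'I_m -> R) (e : 'I_m -> R -> R) (H : 'M[R]_m),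
  [/\ forall i, fe_fun S (e i),
      forall f x, fe_fun S f -> f x = \sum_(i < m) f (p i) * e i x
    & forall u v, C1per L u -> fe_fun S v ->
        H1inner L (fun x => u x - h1proj L H e u x) v = 0].
Proof.
move=> L0 [_ [n [b SE]] SC]; have [m [p [e [ep eS eR]]]] := nodal_basis b.
have SC1 f : fe_fun S f -> C1per L f by move=> Sf; have [df cf pf _] := SC f Sf; exact: And3 df cf pf.
have Se i : fe_fun S (e i) by rewrite SE; exact: eS.
have Ce i : C1per L (e i) by exact: SC1.
have SR f x : fe_fun S f -> f x = \sum_(i < m) f (p i) * e i x.
  by rewrite SE => -[c ->]; exact: eR.
set G : 'M[R]_m := \matrix_(i, j) H1inner L (e i) (e j).
have Gu : G \in unitmx by exact: gram_unit ep Ce.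
exists m, p, e, (invmx G); split => // u v Cu Sv.
have Cp : C1per L (h1proj L (invmx G) e u) by exact: (C1per_sum _ _).1.
rewrite (_ : v = lincomb (fun i => v (p i)) e); last by apply/funext => x; exact: SR.
rewrite H1innerC H1inner_lincomb//; last exact: (C1perB Cu Cp).1.
rewrite big1// => k _; rewrite H1innerC H1innerB// H1inner_lincomb//.
pose rv : 'rV[R]_m := \row_j H1inner L u (e j).
have : (rv *m invmx G *m G) ord0 k = H1inner L u (e k) by rewrite mulmxKV// mxE.
rewrite mxE => <-.
under eq_bigr => i _ do rewrite mxE.
rewrite [X in _ - X](_ : _ = \sum_(i < m) (\sum_(j < m) rv ord0 j * invmx G j i) * G i k).
  by rewrite subrr mulr0.
by apply: eq_bigr => i _; rewrite [G i k]mxE; congr (_ * _); apply: eq_bigr => j _; rewrite mxE.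
Qed.

Lemma young_sq (x y a b : R) : x ^+ 2 + y ^+ 2 <= x * a + y * b ->
  x ^+ 2 + y ^+ 2 <= a ^+ 2 + b ^+ 2.
Proof. by have := sqr_ge0 (x - a); have := sqr_ge0 (y - b); rewrite !expr2; lra. Qed.

(** Since chi - w lies in [S], orthogonality gives (u - w, u - w) = (u - w, u - chi) in H1;
    Cauchy-Schwarz and Young then absorb the factor u - w. *)
Lemma best_approximation L (S : set (R -> R)) u w chi :
  spans S -> (forall f, S f -> C1per L f) -> C1per L u -> S w -> S chi ->
  (forall v, S v -> H1inner L (fun x => u x - w x) v = 0) ->
  L2nrm L (fun x => u x - w x) ^+ 2 + L2nrm L (derive1 (fun x => u x - w x)) ^+ 2 <=
  L2nrm L (fun x => u x - chi x) ^+ 2 + L2nrm L (derive1 (fun x => u x - chi x)) ^+ 2.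
Proof.
move=> SS SC Cu Sw Sc orth.
have Cr := (C1perB Cu (SC _ Sw)).1; have Cx := (C1perB Cu (SC _ Sc)).1.
have Cd := SC _ (spans_sub SS Sc Sw).
have E : H1inner L (fun x => u x - w x) (fun x => u x - w x) =
    H1inner L (fun x => u x - w x) (fun x => u x - chi x).
  rewrite [RHS]H1innerC.
  have -> : H1inner L (fun x => u x - w x) (fun x => u x - w x) =
      H1inner L (fun x => (u x - chi x) + (chi x - w x)) (fun x => u x - w x).
    by congr H1inner; apply/funext => x; rewrite addrA subrK.
  rewrite (H1innerD Cx Cd Cr) (H1innerC L (fun x => chi x - w x)).
  by rewrite (orth _ (spans_sub SS Sc Sw)) addr0.
by apply: young_sq; have := H1inner_le Cr Cx; rewrite -E H1inner_self.
Qed.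

End H1Projection.

(** * Projection error *)

Section Approximation.
Context {R : realType}.
Local Notation mu := (@lebesgue_measure R).
Implicit Types (L : R) (f v w : R -> R) (g : nat -> R -> R).

Lemma L2norm_continuous L f : continuous f -> L2norm L f = (L2nrm L f)%:E.
Proof.
move=> cf; rewrite /L2norm unlock /=.
have -> : (\int[mu]_x (`|((f \_ (period_cell L)) x)%:E| `^ 2) =
    \int[mu]_(x in period_cell L) (f x ^+ 2)%:E)%E.
  rewrite [RHS]integral_mkcond; apply: eq_integral => x _.
  rewrite restrict_EFin/= !patchE; case: ifPn => _ /=.
    by rewrite powR_mulrn// real_normK ?num_real.
  by rewrite normr0 powR0.
have i2 := @continuous_integrable R (- L) L _ (contX2 cf).
rewrite -(fineK (integrable_fin_num _ i2)); last exact: measurable_itv.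
by rewrite poweR_EFin powR12_sqrt// int_sq_ge0.
Qed.

Lemma Rintegral_support (A : R) f : (forall x, A < `|x| -> f x = 0) ->
  \int[mu]_(x in [set: R]) f x = \int[mu]_(x in `[- A, A]) f x.
Proof.
move=> f0; rewrite [RHS]Rintegral_mkcond; apply: eq_Rintegral => x _.
rewrite patchE; case: ifPn => // /negP xA; apply: f0; rewrite ltNge; apply/negP => h.
by apply: xA; rewrite inE/= in_itv/= -ler_norml.
Qed.

Lemma derive1n_support (phi : R -> R) (K : R) n :
  (forall x, K < `|x| -> phi x = 0) -> forall x, K < `|x| -> derive1n n phi x = 0.
Proof.
move=> phi0; elim: n => [//|n IH] x Kx; rewrite derive1nS derive1E.
rewrite -[RHS](@derive_cst R R R 0 x 1); apply: near_eq_derive.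
have : \forall y \near x, K < `|y|.
  exact: (@cvgr_norm_gt _ R _ (nbhs x) _ id x cvg_id K Kx).
by apply: filterS => y; exact: IH.
Qed.

(** Repeated integration by parts, moving one derivative at a time from the test function to [g].
    The integrals are restricted to [[- A, A]], at whose endpoints the test function and all its
    derivatives vanish. *)
Lemma weak_derivative_smooth (r : nat) g : (forall j, (j <= r)%N -> continuous (g j)) ->
  (forall j, (j < r)%N -> forall x : R, is_derive x 1 (g j) (g j.+1 x)) ->
  forall j, (j <= r)%N -> weak_derivative j (g 0%N) (g j).
Proof.
move=> cg dg j jr phi [dphi [K phi0]].
(* [K] may be negative; this choice exceeds it strictly and keeps the interval nonempty. *)
pose A := `|K| + 1.
have A0 : - A <= A by have := normr_ge0 K; rewrite /A; lra.
have KA : K < A by have := ler_norm K; rewrite /A; lra.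
have pd n (x : R) : is_derive x 1 (derive1n n phi) (derive1n n.+1 phi x).
  by rewrite derive1nS derive1E; apply/derivableP; exact: dphi.
have cp n : continuous (derive1n n phi) by apply: derivable_continuous; exact: dphi.
have p0 n x : A <= `|x| -> derive1n n phi x = 0.
  by move=> Ax; apply: derive1n_support phi0 _ _; exact: lt_le_trans Ax.
have sup n w : \int[mu]_(x in [set: R]) (w x * derive1n n phi x) =
    \int[mu]_(x in `[- A, A]) (w x * derive1n n phi x).
  by apply: Rintegral_support => x /ltW Ax; rewrite p0// mulr0.
have step i n : (i < r)%N -> \int[mu]_(x in `[- A, A]) (g i x * derive1n n.+1 phi x) =
    - \int[mu]_(x in `[- A, A]) (g i.+1 x * derive1n n phi x).
  move=> ir; apply/eqP; rewrite -addr_eq0; apply/eqP.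
  have [ci ci1] := (cg i (ltnW ir), cg i.+1 ir).
  rewrite -intD; [|exact: contM..].
  have dd (x : R) : - A <= x <= A -> is_derive x 1 (fun x => g i x * derive1n n phi x)
      (g i x * derive1n n.+1 phi x + g i.+1 x * derive1n n phi x).
    move=> _; have ? := dg i ir x; have ? := pd n x; apply: is_derive_eq.
    by rewrite /GRing.scale/=; ring.
  rewrite (FTC_cont A0 _ dd); last by apply: contD; exact: contM.
  by rewrite !p0 ?mulr0 ?subrr// ?normrN ler_norm.
have main k i : (i + k <= r)%N -> \int[mu]_(x in `[- A, A]) (g i x * derive1n k phi x) =
    (-1) ^+ k * \int[mu]_(x in `[- A, A]) (g (i + k)%N x * derive1n 0 phi x).
  elim: k i => [|k IH] i ik; first by rewrite addn0 expr0 mul1r.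
  rewrite step; last by rewrite (leq_trans _ ik)// addnS ltnS leq_addr.
  by rewrite IH ?addSnnS// exprS mulN1r mulNr.
by rewrite sup (main j 0%N)// add0n -sup derive1n0.
Qed.

Lemma Hs_norm_smooth L (r : nat) g : (forall j, (j <= r)%N -> continuous (g j)) ->
  Hs_norm L r%:R g = (Num.sqrt (\sum_(0 <= j < r.+1) L2nrm L (g j) ^+ 2))%:E.
Proof.
move=> cg; rewrite /Hs_norm natrK subrr eqxx adde0.
have -> : (\sum_(0 <= j < r.+1) L2norm L (g j) ^+ 2 =
   (\sum_(0 <= j < r.+1) L2nrm L (g j) ^+ 2)%:E)%E.
  rewrite -sumEFin; apply: eq_big_nat => j /andP[_ jr].
  by rewrite L2norm_continuous//; exact: cg.
rewrite poweR_EFin powR12_sqrt//.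
by apply: sumr_ge0 => j _; exact: sqr_ge0.
Qed.

Lemma periodic_derivatives L (r : nat) g : periodic (g 0%N) (2 * L) ->
  (forall j, (j < r)%N -> forall x : R, is_derive x 1 (g j) (g j.+1 x)) ->
  forall j, (j <= r)%N -> periodic (g j) (2 * L).
Proof.
move=> p0 dg; elim=> [//|j IH] jr.
exact: is_derive_periodic (IH (ltnW jr)) (dg j jr).
Qed.

Lemma Hs_per_smooth L (r : nat) g : (forall j, (j <= r)%N -> continuous (g j)) ->
  (forall j, (j < r)%N -> forall x : R, is_derive x 1 (g j) (g j.+1 x)) ->
  periodic (g 0%N) (2 * L) -> Hs_per L r%:R (g 0%N) g.
Proof.
move=> cg dg pg; split => //; last by rewrite Hs_norm_smooth// ltry.
rewrite natrK => j jr; split.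
- exact: continuous_measurable_fun (cg j jr).
- exact: periodic_derivatives jr.
- exact: weak_derivative_smooth jr.
Qed.

Lemma mesh_gt0 L r (S : fe_space R) : 0 < L -> is_fe_space L r S -> 0 < mesh S.
Proof.
move=> L0 [[k0 kn kk] _ _].
have n0 : (0 < ncells S)%N.
  rewrite lt0n; apply/eqP => n0; move: kn; rewrite n0 k0 => h; lra.
have := le_bigmax_cond (0 : R) (fun j : 'I_(ncells S) => knot S j.+1 - knot S j)
  (isT : xpredT (Ordinal n0)).
by apply: lt_le_trans; rewrite subr_gt0 kk.
Qed.

Lemma fe_C1per L r (S : fe_space R) f : is_fe_space L r S -> fe_fun S f -> C1per L f.
Proof. by move=> [_ _ H] Sf; have [df cf pf _] := H f Sf; exact: And3 df cf pf. Qed.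

Lemma fe_spans L r (S : fe_space R) : is_fe_space L r S -> spans (fe_fun S).
Proof. by move=> [_ [n [b ->]] _]; exact: spans_lincomb. Qed.

Lemma sqr_sum_le (x y a b B : R) : 0 <= x -> 0 <= y -> 0 <= a -> 0 <= b ->
  x ^+ 2 + y ^+ 2 <= a ^+ 2 + b ^+ 2 -> a + b <= B -> x <= B /\ y <= B.
Proof.
move=> x0 y0 a0 b0 h ab; have ab0 := mulr_ge0 a0 b0.
have B0 : 0 <= B by lra.
have h2 : (a + b) ^+ 2 <= B ^+ 2 by rewrite lerXn2r ?nnegrE// addr_ge0.
have x2 := sqr_ge0 x; have y2 := sqr_ge0 y.
have E : (a + b) ^+ 2 = a ^+ 2 + b ^+ 2 + 2 * (a * b) by ring.
by split; rewrite -(ler_pXn2r (n := 2)) ?nnegrE//; lra.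
Qed.

(** Dividing the weighted derivative term by h costs one power, b <= K h^(r-1), whereas a <= K h^r
    is brought to the same rate with the factor h0. *)
Lemma split_mesh_bound (a b h h0 K : R) (r : nat) : 0 <= a -> 0 <= b -> 0 < h -> h <= h0 -> (0 < r)%N ->
  a + h * b < K * h ^+ r -> a + b <= K * (h0 + 1) * h ^+ r.-1.
Proof.
case: r => // r a0 b0 h_gt0 hh0 _; rewrite exprS /= => H.
set p := h ^+ r in H *; have p0 : 0 < p by exact: exprn_gt0.
have b1 : b <= K * p.
  rewrite -(ler_pM2l h_gt0) [leRHS]mulrCA; apply/ltW; apply: le_lt_trans H.
  by rewrite lerDr.
have Kp : 0 <= K * p by apply: le_trans b1.
have a1 : a <= K * p * h.
  have := mulr_ge0 (ltW h_gt0) b0; have : K * (h * p) = K * p * h by ring.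
  lra.
have := ler_wpM2l Kp hh0; have -> : K * (h0 + 1) * p = K * p * h0 + K * p by ring.
lra.
Qed.

(** The bound is to be applied at every time, so only the common bound [M] on the derivatives enters
    the constant. By best approximation it suffices to exhibit one [chi]: from the infimum on fine
    meshes, the zero function on coarse ones. *)
Lemma projection_error L r (I : Type) (S : I -> fe_space R) (M : R) :
  0 < L -> (1 <= r)%N -> 0 <= M -> (forall i, is_fe_space L r (S i)) ->
  approximation_property L r S ->
  exists2 K : R, 0 < K & forall i w g,
    fe_fun (S i) w -> (forall j, (j <= r)%N -> continuous (g j)) ->
    (forall j, (j < r)%N -> forall x : R, is_derive x 1 (g j) (g j.+1 x)) ->
    periodic (g 0%N) (2 * L) -> (forall j, (j <= r)%N -> L2nrm L (g j) <= M) ->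
    (forall v, fe_fun (S i) v -> H1inner L (fun x => g 0%N x - w x) v = 0) ->
    L2nrm L (fun x => g 0%N x - w x) <= K * mesh (S i) ^+ r.-1 /\
    L2nrm L (derive1 (fun x => g 0%N x - w x)) <= K * mesh (S i) ^+ r.-1.
Proof.
move=> L0 r1 M0 SF [h0 h00 /(_ r%:R)].
have r1' : 1 <= (r%:R : R) <= r%:R by rewrite lexx andbT ler1n.
move=> /(_ r1')[C C0 hC].
(* The square root bounds the H^r norm; the extra 1 makes the bound strict, so that some [chi] lies
   below it although the infimum need not be attained. *)
pose N := Num.sqrt (r.+1%:R * M ^+ 2) + 1.
have N0 : 0 < N by rewrite ltr_wpDl ?sqrtr_ge0.
(* [K1] serves h < h0. [K2] serves h >= h0, where h^(r-1) >= h0^(r-1) turns the trivial bound 2 M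
   into the rate. *)
pose K1 := C * N * (h0 + 1); pose K2 := (M + M) / h0 ^+ r.-1.
have K10 : 0 < K1 by rewrite !mulr_gt0// addr_gt0.
have K20 : 0 <= K2 by rewrite divr_ge0 ?addr_ge0// exprn_ge0// ltW.
exists (K1 + K2); first by rewrite ltr_wpDr.
move=> i w g Sw cg dg pg gM orth.
have Sfe := SF i; have h1 := mesh_gt0 L0 Sfe; set h := mesh (S i) in h1 *.
have Cg : C1per L (g 0%N) by apply: (C1per_intro (dg 0%N r1)) => //; exact: cg.
have dg0 : derive1 (g 0%N) = g 1%N by apply: is_derive_derive1; exact: dg.
have hp : 0 < h ^+ r.-1 by rewrite exprn_gt0.
suff [chi Sc hchi] : exists2 chi, fe_fun (S i) chi &
    L2nrm L (fun x => g 0%N x - chi x) + L2nrm L (derive1 (fun x => g 0%N x - chi x))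
    <= (K1 + K2) * h ^+ r.-1.
  apply: sqr_sum_le hchi; try exact: L2nrm_ge0.
  apply: best_approximation orth => //; first exact: fe_spans Sfe.
  by move=> f Sf; exact: fe_C1per Sfe Sf.
have [hh0|h0h] := ltP h h0.
  have NE : Num.sqrt (\sum_(0 <= j < r.+1) L2nrm L (g j) ^+ 2) < N.
    apply: (@le_lt_trans _ _ (Num.sqrt (r.+1%:R * M ^+ 2))); last by rewrite /N ltrDl.
    rewrite ler_wsqrtr// mulr_natl -[X in _ <= M ^+ 2 *+ X]subn0 -sumr_const_nat.
    rewrite big_nat_cond [leRHS]big_nat_cond; apply: ler_sum => j /andP[/andP[_ jr] _].
    by rewrite lerXn2r ?nnegrE ?L2nrm_ge0// gM.
  have := hC i hh0 _ _ (Hs_per_smooth cg dg pg); rewrite Hs_norm_smooth// -EFinM => hinf.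
  have : (ereal_inf [set L2norm L (g 0%N \- chi)%R + h%:E * L2norm L (g 1%N \- derive1 chi)%R
                 | chi in fe_fun (S i)] < (C * N * h ^+ r)%:E)%E.
    apply: le_lt_trans hinf _; rewrite lte_fin powR_mulrn ?ltW// mulrAC.
    by rewrite ltr_pM2r ?exprn_gt0// ltr_pM2l.
  move=> /ereal_inf_lt[_ [chi Sc <-]].
  have Cc := fe_C1per Sfe Sc; have [_ cc' _] := Cc; have cc := C1per_continuous Cc.
  have cg0 : continuous (g 0%N) by exact: cg.
  have cg1 : continuous (g 1%N) by exact: cg.
  rewrite (L2norm_continuous L (contB cg0 cc)) (L2norm_continuous L (contB cg1 cc')).
  rewrite -EFinM -EFinD lte_fin => hlt; exists chi => //.
  rewrite (C1perB Cg Cc).2 dg0.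
  apply: le_trans (split_mesh_bound (L2nrm_ge0 _ _) (L2nrm_ge0 _ _) h1 (ltW hh0) r1 hlt) _.
  by apply: ler_wpM2r; [exact: ltW|rewrite lerDl].
exists (fun=> 0); first by have [] := fe_spans Sfe.
have -> : (fun x => g 0%N x - 0) = g 0%N by apply/funext => x; rewrite subr0.
rewrite dg0; apply: (@le_trans _ _ (M + M)); first by apply: lerD; exact: gM.
apply: (@le_trans _ _ (K2 * h ^+ r.-1)).
  rewrite /K2 mulrAC ler_pdivlMr ?exprn_gt0// ler_wpM2l ?addr_ge0//.
  by apply: lerXn2r h0h; rewrite nnegrE ltW.
by apply: ler_wpM2r; [exact: ltW|rewrite lerDr ltW].
Qed.

End Approximation.

(** * The energy estimate *)

Section EnergyEstimate.
Context {R : realType}.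
Implicit Types (L : R) (f g u v w : R -> R).

Lemma L2nrmM_le L (M : R) f g : 0 < L -> continuous f -> continuous g ->
  0 <= M -> (forall x, `|f x| <= M) -> L2nrm L (fun x => f x * g x) <= M * L2nrm L g.
Proof.
move=> L0 cf cg M0 fM; rewrite -(ger0_norm M0) -L2nrmZ// /L2nrm ler_wsqrtr//.
apply: int_le; [exact/contX2/contM|exact/contX2/contZ|move=> x _].
by rewrite !exprMn ler_wpM2r ?sqr_ge0// -[leLHS]real_normK ?num_real// lerXn2r ?nnegrE.
Qed.

Lemma C1per_sq L f : C1per L f ->
  C1per L (fun x => f x ^+ 2) /\ derive1 (fun x => f x ^+ 2) = (fun x => 2 * (f x * derive1 f x)).
Proof.
move=> Cf; have cf := C1per_continuous Cf; have [_ cf' pf] := Cf.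
have d (x : R) : is_derive x 1 (fun x => f x ^+ 2) (2 * (f x * derive1 f x)).
  have ? := C1per_derive Cf x; have -> : (fun x => f x ^+ 2) = (fun x => f x * f x) by [].
  by apply: is_derive_eq; rewrite /GRing.scale/=; ring.
split; last exact: is_derive_derive1.
by apply: (C1per_intro d); [exact/contZ/contM|move=> x; rewrite pf].
Qed.

(** With X the left-hand side, integrating the derivative of f^2 against f by parts gives 2 X = -
    X. *)
Lemma square_derive_orthogonal L f : 0 < L -> C1per L f ->
  L2inner L (fun x => f x ^+ 2) (derive1 f) = 0.
Proof.
move=> L0 Cf; have [C2 d2] := C1per_sq Cf.
have [_ cf' _] := Cf; have cf := C1per_continuous Cf.
have := parts_periodic L0 C2 Cf; rewrite d2.
have -> : L2inner L (fun x => 2 * (f x * derive1 f x)) f =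
    2 * L2inner L (fun x => f x ^+ 2) (derive1 f).
  rewrite L2innerZl//; last exact: contM.
  by congr (_ * _); apply: eq_Rintegral => x _; ring.
move: (L2inner _ _ _) => X h; lra.
Qed.

Lemma weak_burgers L f v : 0 < L -> C1per L f -> C1per L v ->
  L2inner L (fun x => f x * derive1 f x) v = - L2inner L (fun x => f x ^+ 2 / 2) (derive1 v).
Proof.
move=> L0 Cf Cv; have [C2 d2] := C1per_sq Cf; have [C3 d3] := C1perZ 2^-1 C2.
have -> : (fun x => f x ^+ 2 / 2) = (fun x => 2^-1 * f x ^+ 2) by apply/funext => x; rewrite mulrC.
rewrite -(parts_periodic L0 C3 Cv) d3 d2; congr L2inner.
by apply/funext => x; rewrite mulrA mulVf// mul1r.
Qed.

Lemma nonlocalJ_periodic L f : C1per L f -> periodic (nonlocalJ L f) (2 * L).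
Proof.
move=> Cf x; apply: eq_Rintegral => xi _; congr (_ * _).
by rewrite addrAC (C1per_derive1_periodic Cf).
Qed.

Lemma half_sq_continuous f : continuous f -> continuous (fun x => f x ^+ 2 / 2).
Proof. by move=> cf; apply: contM; [exact: contX2|move=> x; exact: cvg_cst]. Qed.

Lemma flux_continuous L f : C1per L f -> continuous (flux L f).
Proof.
move=> Cf; have [_ cf' _] := Cf; have cf := C1per_continuous Cf.
apply: contD; last exact: nonlocalJ_continuous.
apply: contB => //.
exact: half_sq_continuous.
Qed.

Lemma flux_periodic L f : C1per L f -> periodic (flux L f) (2 * L).
Proof.
move=> Cf x; have [_ _ pf] := Cf.
by rewrite /flux (nonlocalJ_periodic Cf) (C1per_derive1_periodic Cf) pf.
Qed.

Lemma L2inner_flux L f v : C1per L f -> continuous v ->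
  L2inner L (flux L f) v = L2inner L (fun x => f x ^+ 2 / 2) v
    - L2inner L (derive1 f) v + L2inner L (nonlocalJ L f) v.
Proof.
move=> Cf cv; have [_ cf' _] := Cf; have cf := C1per_continuous Cf.
have c2 : continuous (fun x => f x ^+ 2 / 2) by exact: half_sq_continuous.
by rewrite /flux (L2innerDl L (contB c2 cf') (nonlocalJ_continuous Cf) cv) (L2innerBl L c2 cf' cv).
Qed.

(** Integrating the pointwise bound over a period costs the factor sqrt (2 L), hence the weight
    passed to [nonlocal_sup]. The value 1/4 leaves 3/4 of ||theta_x||^2 for the other terms of the
    energy balance. *)
Lemma nonlocal_L2 L : 0 < L -> exists2 C : R, 0 < C & forall f, C1per L f ->
  L2nrm L (nonlocalJ L f) <= 4^-1 * L2nrm L (derive1 f) + C * L2nrm L f.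
Proof.
move=> L0; set s := Num.sqrt (2 * L).
have s0 : 0 < s by rewrite sqrtr_gt0 mulr_gt0.
have e0 : 0 < 4^-1 / s by rewrite divr_gt0// invr_gt0.
have [C C0 hC] := nonlocal_sup L0 e0.
exists (s * C); first by rewrite mulr_gt0.
move=> f Cf; have cJ := nonlocalJ_continuous Cf.
have a0 : 0 <= 4^-1 / s * L2nrm L (derive1 f) + C * L2nrm L f.
  by rewrite addr_ge0// mulr_ge0 ?L2nrm_ge0// ltW.
apply: le_trans (L2nrm_le_sup L0 a0 cJ (fun x _ => hC f x Cf)) _.
rewrite -/s mulrDr !mulrA le_eqVlt; apply/orP; left; apply/eqP; congr (_ * _ + _).
by field; rewrite gt_eqF.
Qed.

(** Here a, b, c are the values of u, w, u_h, the primed letters those of their derivatives, and j,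
    k, l those of their images under J. Expanding b^2 - c^2 about b leaves (b - c)^2 as the only
    term quadratic in theta. *)
Lemma flux_difference (a b c a' b' c' j k l : R) :
  (a ^+ 2 / 2 - a' + j) - (c ^+ 2 / 2 - c' + l) =
  2^-1 * (a + b) * (a - b) + b * (b - c) - 2^-1 * (b - c) ^+ 2
  - (a' - b') - (b' - c') + (j - k) + (k - l).
Proof. by field. Qed.

(** Read a = ||theta||, b = ||theta_x||, X = (theta_t, theta), and Q as a bound on the projection
    errors. By Young, each of [P * Q * b] and [P * a * b] takes b^2 / 4 out of the available 3/4
    b^2. *)
Lemma energy_algebra (P Q a b X : R) : 0 <= Q -> 0 <= a -> 0 <= b ->
  X <= Q * a + P * Q * b + P * a * b - 3 / 4 * b ^+ 2 ->
  2 * X <= (1 + 2 * P ^+ 2) * (a ^+ 2 + Q ^+ 2).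
Proof.
move=> Q0 a0 b0 h.
have h1 := sqr_ge0 (Q - a); have h2 := sqr_ge0 (b / 2 - P * Q); have h3 := sqr_ge0 (b / 2 - P * a).
have h4 := sqr_ge0 b.
have e1 : (Q - a) ^+ 2 = Q ^+ 2 + a ^+ 2 - 2 * (Q * a) by ring.
have e2 : (b / 2 - P * Q) ^+ 2 = b ^+ 2 / 4 - P * Q * b + P ^+ 2 * Q ^+ 2 by field.
have e3 : (b / 2 - P * a) ^+ 2 = b ^+ 2 / 4 - P * a * b + P ^+ 2 * a ^+ 2 by field.
rewrite e1 in h1; rewrite e2 in h2; rewrite e3 in h3.
have -> : (1 + 2 * P ^+ 2) * (a ^+ 2 + Q ^+ 2) =
  a ^+ 2 + Q ^+ 2 + 2 * (P ^+ 2 * a ^+ 2) + 2 * (P ^+ 2 * Q ^+ 2) by ring.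
lra.
Qed.

(** Bookkeeping of the energy balance: [p], [q] are the norms of rho and rho_x, [n1], [n2] those of
    the products (u + w) rho / 2 and w theta, [n3] that of u_t - w_t, [J1], [J2] those of J rho and
    J theta. Each X is an inner product with theta_x, except [X0], which is with theta; index 3 is
    left to the vanishing cubic term. The coefficient 3/4 is 1 - 1/4, the quarter being spent on J
    theta. *)
Lemma energy_collect (M C Q a b p q n1 n2 n3 J1 J2 X0 X1 X2 X4 X5 X6 X7 : R) :
  0 <= M -> 0 <= C -> 0 <= Q -> 0 <= a -> 0 <= b -> p <= Q -> q <= Q ->
  n1 <= M * p -> n2 <= M * a -> n3 <= Q -> J1 <= 4^-1 * q + C * p -> J2 <= 4^-1 * b + C * a ->
  `|X0| <= n3 * a -> `|X1| <= n1 * b -> `|X2| <= n2 * b -> `|X4| <= q * b -> X5 = b ^+ 2 ->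
  `|X6| <= J1 * b -> `|X7| <= J2 * b ->
  X1 + X2 - X4 - X5 + X6 + X7 - X0 <=
    Q * a + (M + C + 2) * Q * b + (M + C + 2) * a * b - 3 / 4 * b ^+ 2.
Proof.
move=> M0 C0 Q0 a0 b0 pQ qQ h1 h2 h3 h4 h5 y0 y1 y2 y4 -> y6 y7.
have := ler_norm X1; have := ler_norm X2; have := ler_norm X6; have := ler_norm X7.
have := lerNnormlW (lexx `|X0|); have := lerNnormlW (lexx `|X4|).
have k1 : n1 * b <= M * Q * b by rewrite ler_wpM2r//; apply: le_trans h1 _; rewrite ler_wpM2l.
have k2 : n2 * b <= M * a * b by rewrite ler_wpM2r.
have k3 : n3 * a <= Q * a by rewrite ler_wpM2r.
have k4 : q * b <= Q * b by rewrite ler_wpM2r.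
have k6 : J1 * b <= (4^-1 * Q + C * Q) * b.
  by rewrite ler_wpM2r//; apply: le_trans h4 _; rewrite lerD// ler_wpM2l// invr_ge0.
have k7 : J2 * b <= (4^-1 * b + C * a) * b by rewrite ler_wpM2r.
have Qb := mulr_ge0 Q0 b0; have ab := mulr_ge0 a0 b0.
have -> : (M + C + 2) * Q * b = M * Q * b + C * Q * b + 2 * (Q * b) by ring.
have -> : (M + C + 2) * a * b = M * a * b + C * a * b + 2 * (a * b) by ring.
have e6 : (4^-1 * Q + C * Q) * b = 4^-1 * (Q * b) + C * Q * b by ring.
have e7 : (4^-1 * b + C * a) * b = 4^-1 * b ^+ 2 + C * a * b by ring.
rewrite e6 in k6; rewrite e7 in k7.
lra.
Qed.

(** [C] depends on [L] and [M] alone, hence is the same for all meshes and all times. *)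
Lemma energy_estimate L (M : R) : 0 < L -> 0 <= M -> exists2 C : R, 0 < C &
  forall (S : set (R -> R)) u ut w wt uh uht (Q : R),
    spans S -> (forall f, S f -> C1per L f) -> C1per L u -> S w -> S uh ->
    continuous ut -> continuous wt -> continuous uht ->
    (forall v, S v -> L2inner L ut v = L2inner L (flux L u) (derive1 v)) ->
    (forall v, S v -> L2inner L uht v = L2inner L (flux L uh) (derive1 v)) ->
    (forall x, `|u x| <= M) -> (forall x, `|w x| <= M) -> 0 <= Q ->
    L2nrm L (fun x => u x - w x) <= Q -> L2nrm L (derive1 (fun x => u x - w x)) <= Q ->
    L2nrm L (fun x => ut x - wt x) <= Q ->
    2 * L2inner L (fun x => wt x - uht x) (fun x => w x - uh x) <=
      C * (L2nrm L (fun x => w x - uh x) ^+ 2 + Q ^+ 2).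
Proof.
move=> L0 M0; have [C C0 hC] := nonlocal_L2 L0.
exists (1 + 2 * (M + C + 2) ^+ 2); first by apply: ltr_wpDr; rewrite // mulr_ge0// sqr_ge0.
move=> S u ut w wt uh uht Q SS SC Cu Sw Sh cut cwt cuht weaku weakh uM wM Q0.
set rho := fun x => u x - w x; set th := fun x => w x - uh x.
move=> rQ rQ' rtQ.
have Cw := SC _ Sw; have Ch := SC _ Sh.
have Sth : S th by exact: spans_sub.
have Cr : C1per L rho by exact: (C1perB Cu Cw).1.
have Ct : C1per L th by exact: SC.
have [cu cw ch] := And3 (C1per_continuous Cu) (C1per_continuous Cw) (C1per_continuous Ch).
have [cr ct] := (C1per_continuous Cr, C1per_continuous Ct).
have [[_ cr' _] [_ ct' _]] := (Cr, Ct).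
have [cJr cJt] := (nonlocalJ_continuous Cr, nonlocalJ_continuous Ct).
pose A1 x := (2^-1 * (u x + w x)) * rho x.
pose A2 x := w x * th x.
pose A3 x := 2^-1 * th x ^+ 2.
have cuw : continuous (fun x => 2^-1 * (u x + w x)) by exact/contZ/contD.
have c1 : continuous A1 by exact: contM.
have c2 : continuous A2 by exact: contM.
have c3 : continuous A3 by exact/contZ/contX2.
have fluxE : (fun x => flux L u x - flux L uh x) =
    (fun x => A1 x + A2 x - A3 x - derive1 rho x - derive1 th x + nonlocalJ L rho x + nonlocalJ L th x).
  apply/funext => x; rewrite /rho /th (nonlocalJB Cu Cw) (nonlocalJB Cw Ch).
  rewrite (C1perB Cu Cw).2 (C1perB Cw Ch).2; exact: flux_difference.
have E : L2inner L (fun x => wt x - uht x) th =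
    L2inner L A1 (derive1 th) + L2inner L A2 (derive1 th)
    - L2inner L (derive1 rho) (derive1 th) - L2inner L (derive1 th) (derive1 th)
    + L2inner L (nonlocalJ L rho) (derive1 th) + L2inner L (nonlocalJ L th) (derive1 th)
    - L2inner L (fun x => ut x - wt x) th.
  (* Only u_t - u_ht is governed by the two weak equations; the remainder u_t - w_t is the
     projection error of u_t. *)
  have -> : (fun x => wt x - uht x) = (fun x => (ut x - uht x) - (ut x - wt x)).
    by apply/funext => x; rewrite opprB [RHS]addrC addrA subrK.
  rewrite (L2innerBl L (contB cut cuht) (contB cut cwt) ct); congr (_ - _).
  rewrite (L2innerBl L cut cuht ct) (weaku _ Sth) (weakh _ Sth).
  rewrite -(L2innerBl L (flux_continuous Cu) (flux_continuous Ch) ct') fluxE.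
  rewrite (L2innerDl L _ cJt ct'); last exact/contD/cJr/contB/ct'/contB/cr'/contB/c3/contD.
  rewrite (L2innerDl L _ cJr ct'); last exact/contB/ct'/contB/cr'/contB/c3/contD.
  rewrite (L2innerBl L _ ct' ct'); last exact/contB/cr'/contB/c3/contD.
  rewrite (L2innerBl L _ cr' ct'); last exact/contB/c3/contD.
  rewrite (L2innerBl L _ c3 ct'); last exact/contD.
  rewrite (L2innerDl L c1 c2 ct').
  rewrite (L2innerZl L 2^-1 (contX2 ct) ct') square_derive_orthogonal//.
  by rewrite mulr0 subr0.
apply: (@energy_algebra _ Q _ (L2nrm L (derive1 th))) => //; try exact: L2nrm_ge0.
rewrite E.
have uwM x : `|2^-1 * (u x + w x)| <= M.
  rewrite normrM ger0_norm ?invr_ge0// ler_pdivrMl//.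
  by apply: le_trans (ler_normD _ _) _; have := uM x; have := wM x; clear; lra.
apply: (@energy_collect M C Q _ _ _ _ _ _ _ _ _ _ _ _ _ _ _ _ M0 (ltW C0) Q0 (L2nrm_ge0 _ _) (L2nrm_ge0 _ _) rQ rQ').
- exact: (L2nrmM_le L0 cuw cr M0 uwM).
- exact: (L2nrmM_le L0 cw ct M0 wM).
- exact: rtQ.
- exact: hC.
- exact: hC.
- by apply: L2inner_le => //; exact: contB.
- exact: L2inner_le.
- exact: L2inner_le.
- exact: L2inner_le.
- by rewrite L2nrm_inner.
- exact: L2inner_le.
- exact: L2inner_le.
Qed.

End EnergyEstimate.

(** * Dependence on time *)

Section TimeDependence.
Context {R : realType}.
Local Notation mu := (@lebesgue_measure R).
Implicit Types (L T : R) (f : R -> R -> R).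

(** Differentiation under the integral, the uniform bound [K] on the time derivative providing the
    dominating function. *)
Lemma is_derive_int L T (K : R) f f1 (b : R -> R) :
  (forall t x : R, 0 < t < T -> is_derive t 1 (f ^~ x) (f1 t x)) ->
  (forall t, 0 < t < T -> continuous (f t)) -> continuous b ->
  (forall t x : R, 0 < t < T -> `|x| <= L -> `|f1 t x| <= K) ->
  forall t : R, 0 < t < T ->
    is_derive t 1 (fun s => L2inner L (f s) b) (L2inner L (f1 t) b).
Proof.
move=> df cf cb fK t tT.
have I0 : `]0, T[%classic t by rewrite /= in_itv.
have i1 (s : R) : `]0, T[%classic s -> mu.-integrable (period_cell L) (EFin \o (fun x => f s x * b x)).
  by rewrite /= in_itv/= => sT; apply: continuous_integrable; apply: contM => //; exact: cf.
have d1 (s x : R) : 0 < s < T -> is_derive s 1 (fun s => f s x * b x) (f1 s x * b x).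
  move=> sT; have ? := df s x sT.
  by apply: is_derive_eq; rewrite /GRing.scale/= mulr0 add0r mulrC.
have i2 : mu.-integrable (period_cell L) (EFin \o (fun x => `|K| * `|b x|)).
  by apply: continuous_integrable; apply: contZ; exact: cont_norm.
have G0 (x : R) : 0 <= `|K| * `|b x| by rewrite mulr_ge0.
have Gub (s x : R) : `]0, T[%classic s -> period_cell L x ->
    `|partial1of2 (fun s x => f s x * b x) s x| <= `|K| * `|b x|.
  rewrite /period_cell/= !in_itv/= => sT xL.
  rewrite partial1of2E (@derive_val _ _ _ _ _ _ _ (d1 s x sT)) normrM ler_wpM2r//.
  by rewrite (le_trans (fK s x sT _) (ler_norm K))// ler_norml.
have d2 (s x : R) : `]0, T[%classic s -> period_cell L x -> derivable (fun s => f s x * b x) s 1.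
  by rewrite /= in_itv/= => sT _; have [] := d1 s x sT.
have mL : measurable (period_cell L) by exact: measurable_itv.
have h1 := @derivable_under_integral R _ _ mu (fun s x => f s x * b x) _ mL t 0 T I0 i1 d2 _ G0 i2 Gub.
have h2 := @differentiation_under_integral R _ _ mu (fun s x => f s x * b x) _ mL t 0 T I0 i1 d2 _ G0 i2 Gub.
apply: DeriveDef; first exact: h1.
rewrite -derive1E; apply: (etrans h2); apply: eq_Rintegral => x _.
by rewrite partial1of2E (@derive_val _ _ _ _ _ _ _ (d1 t x tT)).
Qed.

Lemma lipschitz_within (a b K : R) (F : R -> R) :
  (forall s t, a <= s <= b -> a <= t <= b -> `|F s - F t| <= K * `|s - t|) ->
  {within `[a, b], continuous F}.
Proof.
move=> lip; apply/subspace_continuousP => t /=; rewrite in_itv/= => tab.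
apply/cvgrPdist_le => e e0; near=> s.
have sab : a <= s <= b by have : `[a, b]%classic s by near: s; exact: withinT; rewrite /= in_itv.
apply: le_trans (lip _ _ tab sab) _.
apply: (@le_trans _ _ ((`|K| + 1) * `|t - s|)).
  by rewrite ler_wpM2r// (le_trans (ler_norm K))// lerDl.
rewrite -ler_pdivlMl ?ltr_wpDl//.
near: s; apply: cvg_within; near=> s.
near: s; apply: (@cvgr_dist_le _ _ _ _ _ id t) => //; rewrite mulr_gt0// invr_gt0 ltr_wpDl//.
Unshelve. all: by end_near. Qed.

Lemma time_lipschitz T (K : R) (F F1 : R -> R) : 0 < T ->
  {within `[0, T], continuous F} -> (forall t : R, 0 < t < T -> is_derive t 1 F (F1 t)) ->
  (forall t, 0 < t < T -> `|F1 t| <= K) ->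
  forall s t, 0 <= s <= T -> 0 <= t <= T -> `|F s - F t| <= K * `|s - t|.
Proof.
move=> T0 cF dF FK s t; wlog ts : s t / t <= s.
  move=> H sT tT; have [/H|/ltW/H] := leP t s; first exact.
  by rewrite distrC [`|s - t|]distrC; exact.
move=> /andP[s0 sT] /andP[t0 tT].
have [->|st] := eqVneq s t; first by rewrite !subrr !normr0 mulr0.
have {st}ts : t < s by rewrite lt_def st.
have sub (x : R) : x \in `]t, s[ -> 0 < x < T.
  by rewrite in_itv/= => /andP[h1 h2]; rewrite (le_lt_trans t0 h1) (lt_le_trans h2 sT).
have cts : {within `[t, s], continuous F}.
  by apply: continuous_subspaceW cF; apply: subset_itv; rewrite bnd_simp.
have [c /sub cT ->] := MVT ts (fun x hx => dF x (sub x hx)) cts.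
by rewrite normrM ler_wpM2r// FK.
Qed.

(** Differentiation under the integral reaches interior times only. Continuity up to 0 and [T] comes
    from a Lipschitz bound in time: the mean value theorem at each x, then integration. *)
Lemma L2inner_time_continuous L T (K : R) f f1 (b : R -> R) : 0 < T ->
  (forall x, {within `[0, T], continuous (f ^~ x)}) ->
  (forall t x : R, 0 < t < T -> is_derive t 1 (f ^~ x) (f1 t x)) ->
  (forall t, 0 <= t <= T -> continuous (f t)) -> continuous b ->
  (forall t x : R, 0 < t < T -> `|x| <= L -> `|f1 t x| <= K) ->
  {within `[0, T], continuous (fun s => L2inner L (f s) b)}.
Proof.
move=> T0 ctf df cf cb fK.
apply: (@lipschitz_within 0 T (`|K| * \int[mu]_(x in `[- L, L]) `|b x|)) => s t sT tT.
have [cs ct] := (cf s sT, cf t tT).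
rewrite -(L2innerBl L cs ct cb) /L2inner /period_cell.
apply: le_trans (le_normr_Rintegral _ _) _ => //.
  by apply: continuous_integrable; apply: contM => //; exact: contB.
rewrite mulrAC -intZ; last exact: cont_norm.
apply: int_le.
- by apply: cont_norm; apply: contM => //; exact: contB.
- by apply: contZ; exact: cont_norm.
move=> x xL; rewrite normrM ler_wpM2r//.
apply: le_trans (time_lipschitz (K := K) T0 (ctf x) (fun t tT => df t x tT) _ sT tT) _; last first.
  by rewrite ler_wpM2r// ler_norm.
by move=> r rT; apply: fK => //; rewrite ler_norml.
Qed.

Lemma joint_continuous_space T f : {within `[0, T] `*` [set: R], continuous (fun p : R * R => f p.1 p.2)} ->
  forall t, 0 <= t <= T -> continuous (f t).
Proof.
move=> /subspace_continuousP cf t tT x.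
have At : (`[0, T] `*` [set: R])%classic (t, x) by split => //=; rewrite in_itv.
apply: (@cvg_comp _ _ _ (fun y => (t, y)) (fun p : R * R => f p.1 p.2) _ _ _ _ (cf _ At)).
move=> W /= [[A B] /= [At' Bx] AB]; near=> y; apply: AB => /=.
- by split; [exact: nbhs_singleton|near: y].
- by split => //=; rewrite in_itv.
Unshelve. all: by end_near. Qed.

Lemma joint_continuous_time T f : {within `[0, T] `*` [set: R], continuous (fun p : R * R => f p.1 p.2)} ->
  forall x, {within `[0, T], continuous (f ^~ x)}.
Proof.
move=> /subspace_continuousP cf x; apply/subspace_continuousP => t tT.
have At : (`[0, T] `*` [set: R])%classic (t, x) by split.
apply: (@cvg_comp _ _ _ (fun s => (s, x)) (fun p : R * R => f p.1 p.2) _ _ _ _ (cf _ At)).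
move=> W /= [[A B] /= [At' Bx] AB]; rewrite /nbhs/=/within/=; near=> y => yT; apply: AB => /=.
- by split; [near: y|exact: nbhs_singleton].
- by split.
Unshelve. all: by end_near. Qed.

Lemma joint_continuous_bounded L T f : 0 < L -> 0 < T ->
  {within `[0, T] `*` [set: R], continuous (fun p : R * R => f p.1 p.2)} ->
  exists2 K : R, 0 <= K & forall t x : R, 0 <= t <= T -> `|x| <= L -> `|f t x| <= K.
Proof.
move=> L0 T0 cf; pose A : set (R * R) := `[0, T]%classic `*` `[- L, L]%classic.
have cA : compact A by apply: compact_setX; exact: segment_compact.
have A0 : A !=set0.
  exists (0, 0); split; rewrite /= in_itv/= ?lexx ?(ltW T0)//.
  by rewrite oppr_le0 (ltW L0).
have cn : {within A, continuous (fun p : R * R => `|f p.1 p.2|)}.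
  have cfA : {within A, continuous (fun p : R * R => f p.1 p.2)}.
    by apply: continuous_subspaceW cf => p [].
  by move=> p; apply: cvg_norm; exact: cfA.
have [c _ cP] := compact_EVT_max A0 cA cn.
exists `|f c.1 c.2| => // t x tT xL; apply: (cP (t, x)); rewrite inE; split => /=.
- by rewrite in_itv.
- by rewrite in_itv/= -ler_norml.
Qed.

(** The function exp(-C t) (E t + G) has nonpositive derivative at interior times and is continuous
    up to the endpoints, so it is nonincreasing. *)
Lemma gronwall T (C G : R) (E E1 : R -> R) : 0 < C -> 
  {within `[0, T], continuous E} -> (forall t : R, 0 < t < T -> is_derive t 1 E (E1 t)) ->
  (forall t, 0 < t < T -> E1 t <= C * (E t + G)) ->
  forall t, 0 <= t <= T -> E t + G <= expR (C * t) * (E 0 + G).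
Proof.
move=> C0 cE dE hE t tT.
pose F (s : R) := expR (- C * s) * (E s + G).
have dexp (s : R) : is_derive s 1 (fun s => expR (- C * s)) (- C * expR (- C * s)).
  by apply: is_derive_eq; rewrite /GRing.scale/=; ring.
have dF (s : R) : 0 < s < T -> is_derive s 1 F (expR (- C * s) * (E1 s - C * (E s + G))).
  move=> sT; have ? := dE s sT; have ? := dexp s.
  by apply: is_derive_eq; rewrite /GRing.scale/=; ring.
have cF : {within `[0, T], continuous F}.
  move=> s; apply: cvgM.
    apply: (continuous_subspaceT (A := `[0, T]%classic) (f := fun s => expR (- C * s))).
    by move=> r; apply/differentiable_continuous/derivable1_diffP; exact: ex_derive.
  by apply: cvgD; [exact: cE|exact: cvg_cst].
have FF : F t <= F 0.
  have T0 : 0 <= T by case/andP: tT => h1 h2; exact: le_trans h2.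
  have d1 (s : R) : s \in `]0, T[ -> derivable F s 1 by rewrite in_itv/= => /dF[].
  have d2 (s : R) : s \in `]0, T[ -> derive1 F s <= 0.
    rewrite in_itv/= => sT; rewrite derive1E (@derive_val _ _ _ _ _ _ _ (dF s sT)).
    by rewrite mulr_ge0_le0 ?expR_ge0// subr_le0 hE.
  apply: (ler0_derive1_le_cc d1 d2 cF); rewrite ?in_itv/= ?lexx ?T0//.
  by case/andP: tT.
move: FF; rewrite /F mulr0 expR0 mul1r mulNr expRN => h.
by rewrite -ler_pdivrMl ?expR_gt0.
Qed.

End TimeDependence.

(** * Semidiscrete evolution *)

Section DiscreteError.
Context {R : realType}.
Local Notation mu := (@lebesgue_measure R).
Implicit Types (L T : R).

Lemma is_derive_dot n (a b : 'I_n -> R -> R) (a1 b1 : 'I_n -> R) (t : R) :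
  (forall i, is_derive t 1 (a i) (a1 i)) -> (forall i, is_derive t 1 (b i) (b1 i)) ->
  is_derive t 1 (fun s => \sum_(i < n) a i s * b i s) (\sum_(i < n) (a1 i * b i t + a i t * b1 i)).
Proof.
elim: n a b a1 b1 => [|n IH] a b a1 b1 da db.
  rewrite big_ord0 (_ : (fun s => _) = fun=> 0); first exact: is_derive_cst.
  by apply/funext => s; rewrite big_ord0.
rewrite big_ord_recl.
have -> : (fun s => \sum_(i < n.+1) a i s * b i s) =
    (fun s => a ord0 s * b ord0 s + \sum_(i < n) a (lift ord0 i) s * b (lift ord0 i) s).
  by apply/funext => s; rewrite big_ord_recl.
have ? := IH _ _ _ _ (fun i => da (lift ord0 i)) (fun i => db (lift ord0 i)).
have ? := da ord0; have ? := db ord0.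
by apply: is_derive_eq; rewrite /GRing.scale/=; congr (_ + _); ring.
Qed.

Lemma is_derive_dot_cst n (a : 'I_n -> R -> R) (a1 b : 'I_n -> R) (t : R) :
  (forall i, is_derive t 1 (a i) (a1 i)) ->
  is_derive t 1 (fun s => \sum_(i < n) a i s * b i) (\sum_(i < n) a1 i * b i).
Proof.
move=> da; have := @is_derive_dot n a (fun i => cst (b i)) a1 (fun=> 0) t da
  (fun i => is_derive_cst _ _ _).
by move=> h; apply: is_derive_eq; apply: eq_bigr => i _; rewrite mulr0 addr0.
Qed.

Lemma within_dot n (A : set R) (a b : 'I_n -> R -> R) :
  (forall i, {within A, continuous (a i)}) -> (forall i, {within A, continuous (b i)}) ->
  {within A, continuous (fun s => \sum_(i < n) a i s * b i s)}.
Proof.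
elim: n a b => [|n IH] a b ca cb.
  have -> : (fun s => \sum_(i < 0) a i s * b i s) = (fun=> 0).
    by apply/funext => s; rewrite big_ord0.
  by apply: continuous_subspaceT => x; exact: cvg_cst.
have -> : (fun s => \sum_(i < n.+1) a i s * b i s) =
    (fun s => a ord0 s * b ord0 s + \sum_(i < n) a (lift ord0 i) s * b (lift ord0 i) s).
  by apply/funext => s; rewrite big_ord_recl.
have c := IH _ _ (fun i => ca (lift ord0 i)) (fun i => cb (lift ord0 i)).
move=> x; apply: cvgD; last exact: c.
by apply: cvgM; [exact: ca|exact: cb].
Qed.

Lemma within_dot_cst n (A : set R) (a : 'I_n -> R -> R) (b : 'I_n -> R) :
  (forall i, {within A, continuous (a i)}) ->
  {within A, continuous (fun s => \sum_(i < n) a i s * b i)}.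
Proof.
move=> ca; apply: (within_dot ca (b := fun i => cst (b i))) => i.
by apply: continuous_subspaceT => x; exact: cvg_cst.
Qed.

Lemma lincomb_continuous n (c : 'I_n -> R) (b : 'I_n -> R -> R) :
  (forall i, continuous (b i)) -> continuous (lincomb c b).
Proof.
elim: n c b => [|n IH] c b cb.
  have -> : lincomb c b = (fun=> 0) by apply/funext => s; rewrite /lincomb big_ord0.
  by move=> x; exact: cvg_cst.
have -> : lincomb c b = (fun x => c ord0 * b ord0 x
    + lincomb (fun i => c (lift ord0 i)) (fun i => b (lift ord0 i)) x).
  by apply/funext => x; rewrite /lincomb big_ord_recl.
by apply: contD; [exact: contZ|exact: IH].
Qed.

Lemma L2inner_lincomb L n (c : 'I_n -> R) (b : 'I_n -> R -> R) g :
  (forall i, continuous (b i)) -> continuous g ->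
  L2inner L (lincomb c b) g = \sum_(i < n) c i * L2inner L (b i) g.
Proof.
move=> cb cg; elim: n c b cb => [|n IH] c b cb.
  rewrite big_ord0 -[RHS](mul0r (L2inner L g g)) -(L2innerZl L 0 cg cg).
  by congr L2inner; apply/funext => x; rewrite /lincomb big_ord0 mul0r.
rewrite big_ord_recl -(IH _ _ (fun i => cb (lift ord0 i))) -(L2innerZl L (c ord0) (cb ord0) cg).
have c1 := contZ (c := c ord0) (cb ord0).
have c2 := lincomb_continuous (c := fun i => c (lift ord0 i)) (fun i => cb (lift ord0 i)).
rewrite -(L2innerDl L c1 c2 cg).
by congr L2inner; apply/funext => x; rewrite /lincomb big_ord_recl.
Qed.

Lemma open_interval_near T (t : R) : 0 < t < T -> \forall s \near t, 0 <= s <= T.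
Proof.
move=> tT; have : t \in `]0, T[ by rewrite in_itv.
move=> /near_in_itvoo; apply: filterS => s; rewrite in_itv/= => /andP[h1 h2].
by rewrite !ltW.
Qed.

(** The time derivative is given only at each fixed x. In the nodal coordinates [th t (p i)], both
    [th t] and its squared norm are finite sums, so continuity, differentiability and membership of
    [th1 t] in the space follow without exchanging limits and integrals. *)
Lemma square_norm_in_time L T r (S : fe_space R) (th th1 : R -> R -> R) :
  0 < L -> is_fe_space L r S -> (forall t, 0 <= t <= T -> fe_fun S (th t)) ->
  (forall x, {within `[0, T], continuous (th ^~ x)}) ->
  (forall t x : R, 0 < t < T -> is_derive t 1 (th ^~ x) (th1 t x)) ->
  [/\ forall t, 0 < t < T -> fe_fun S (th1 t),
      {within `[0, T], continuous (fun t => L2nrm L (th t) ^+ 2)}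
    & forall t : R, 0 < t < T ->
        is_derive t 1 (fun t => L2nrm L (th t) ^+ 2) (2 * L2inner L (th1 t) (th t))].
Proof.
move=> L0 SF thS cth dth; have [m [p [e [H [eS eR _]]]]] := fe_space_basis L0 SF.
have ce i : continuous (e i) by exact: C1per_continuous (fe_C1per SF (eS i)).
pose G i j := L2inner L (e i) (e j).
pose z i t := th t (p i).
have thE t : 0 <= t <= T -> th t = lincomb (z ^~ t) e.
  by move=> tT; apply/funext => x; apply: eR; exact: thS.
have oc (t : R) : 0 < t < T -> 0 <= t <= T by move=> /andP[h1 h2]; rewrite !ltW.
have th1E t : 0 < t < T -> th1 t = lincomb (fun i => th1 t (p i)) e.
  move=> tT; apply/funext => x.
  have d1 := dth t x tT.
  have d2 := is_derive_dot_cst (fun i => e i x) (fun i => dth t (p i) tT).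
  rewrite /lincomb -(@derive_val _ _ _ _ _ _ _ d1) -(@derive_val _ _ _ _ _ _ _ d2).
  (* At an interior time the nodal expansion holds for all nearby times, so its two sides have the
     same derivative. *)
  apply: near_eq_derive; have := open_interval_near tT; apply: filterS => s sT.
  exact: eR _ _ (thS s sT).
pose y i t := \sum_(j < m) z j t * G i j.
have EE t : 0 <= t <= T -> L2nrm L (th t) ^+ 2 = \sum_(i < m) z i t * y i t.
  move=> tT; have ct : continuous (th t) by exact: C1per_continuous (fe_C1per SF (thS t tT)).
  rewrite L2nrm_inner {1}(thE t tT) L2inner_lincomb//; apply: eq_bigr => i _; congr (_ * _).
  rewrite L2innerC (thE t tT) L2inner_lincomb//; apply: eq_bigr => j _; congr (_ * _).
  exact: L2innerC.
split.
- by move=> t tT; rewrite th1E//; apply: spans_sum => //; exact: fe_spans SF.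
- apply: (@subspace_eq_continuous _ _ _ (fun t => \sum_(i < m) z i t * y i t)).
    by move=> t; rewrite inE/= in_itv/= => tT; exact/esym/EE.
  apply: within_dot => i; first exact: cth.
  by apply: within_dot_cst => j; exact: cth.
- move=> t tT.
  have dz i : is_derive t 1 (z i) (th1 t (p i)) by exact: dth.
  have dy i : is_derive t 1 (y i) (\sum_(j < m) th1 t (p j) * G i j) by exact: is_derive_dot_cst.
  have near_E : \forall s \near t, \sum_(i < m) z i s * y i s = L2nrm L (th s) ^+ 2.
    by have := open_interval_near tT; apply: filterS => s sT; rewrite EE.
  apply: (near_eq_is_derive near_E); apply: is_derive_eq (is_derive_dot dz dy) _.
  have ct : continuous (th t) by exact: C1per_continuous (fe_C1per SF (thS t (oc t tT))).
  have ct1 : continuous (th1 t) by rewrite th1E//; exact: lincomb_continuous.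
  have lt u (c : 'I_m -> R) i : u = lincomb c e -> L2inner L (e i) u = \sum_(j < m) c j * G i j.
    move=> ->; rewrite L2innerC L2inner_lincomb//.
    by apply: eq_bigr => j _; congr (_ * _); exact: L2innerC.
  (* The product rule yields two sums; by symmetry of the Gram form both equal (theta_t, theta),
     whence the factor 2. *)
  have e1 : L2inner L (th1 t) (th t) = \sum_(i < m) th1 t (p i) * y i t.
    rewrite [in LHS](th1E t tT) L2inner_lincomb//; apply: eq_bigr => i _; congr (_ * _).
    by rewrite (lt _ (z ^~ t))//; exact/thE/oc.
  have e2 : L2inner L (th1 t) (th t) = \sum_(i < m) z i t * \sum_(j < m) th1 t (p j) * G i j.
    rewrite [LHS]L2innerC [in LHS](thE t (oc t tT)) L2inner_lincomb//.
    apply: eq_bigr => i _; congr (_ * _).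
    by rewrite (lt _ (fun i => th1 t (p i)))//; exact: th1E.
  by rewrite big_split/= -e1 -e2 -mulr2n mulr_natl.
Qed.

(* [D00], [D01], [D10], [D11] stand for u, u_x, u_t, u_tx. *)
Lemma projection_in_time L T r (S : fe_space R) (D00 D01 D10 D11 : R -> R -> R) :
  let jcont D := {within `[0, T] `*` [set: R], continuous (fun p : R * R => D p.1 p.2)} in
  0 < L -> 0 < T -> is_fe_space L r S ->
  [/\ jcont D00, jcont D01, jcont D10 & jcont D11] ->
  (forall t x : R, 0 < t < T -> is_derive t 1 (D00 ^~ x) (D10 t x)) ->
  (forall t x : R, 0 < t < T -> is_derive t 1 (D01 ^~ x) (D11 t x)) ->
  (forall t x : R, 0 <= t <= T -> is_derive x 1 (D00 t) (D01 t x)) ->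
  (forall t x : R, 0 <= t <= T -> is_derive x 1 (D10 t) (D11 t x)) ->
  (forall t, 0 <= t <= T -> C1per L (D00 t)) ->
  (forall t, 0 < t < T -> C1per L (D10 t)) ->
  exists w wt : R -> R -> R,
  [/\ forall t, fe_fun S (w t) /\ fe_fun S (wt t),
      forall t v, 0 <= t <= T -> fe_fun S v -> H1inner L (fun x => D00 t x - w t x) v = 0,
      forall t v, 0 < t < T -> fe_fun S v -> H1inner L (fun x => D10 t x - wt t x) v = 0,
      forall x, {within `[0, T], continuous (w ^~ x)}
    & forall t x : R, 0 < t < T -> is_derive t 1 (w ^~ x) (wt t x)].
Proof.
move=> jcont L0 T0 SF [j00 j01 j10 j11] dt0 dt1 dx0 dx1 C00 C10.
have [m [p [e [H [eS eR eP]]]]] := fe_space_basis L0 SF.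
have Ce i : C1per L (e i) by exact: fe_C1per SF (eS i).
have ce i : continuous (e i) by exact: C1per_continuous.
have ce' i : continuous (derive1 (e i)) by have [] := Ce i.
(* These are the H1 moments of u against the basis. [D01] replaces the spatial derivative of [D00],
   so that differentiation under the integral gives a time derivative involving [D11]. *)
pose c j t := L2inner L (D00 t) (e j) + L2inner L (D01 t) (derive1 (e j)).
pose c1 j t := L2inner L (D10 t) (e j) + L2inner L (D11 t) (derive1 (e j)).
pose w t := lincomb (fun i => \sum_(j < m) c j t * H j i) e.
pose wt t := lincomb (fun i => \sum_(j < m) c1 j t * H j i) e.
have oc (t : R) : 0 < t < T -> 0 <= t <= T by move=> /andP[h1 h2]; rewrite !ltW.
have wE t : 0 <= t <= T -> w t = h1proj L H e (D00 t).
  move=> tT; apply/funext => x; apply: eq_bigr => i _; congr (_ * _).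
  apply: eq_bigr => j _; rewrite /H1inner.
  by rewrite (is_derive_derive1 (fun x => dx0 t x tT)).
have wtE t : 0 < t < T -> wt t = h1proj L H e (D10 t).
  move=> tT; apply/funext => x; apply: eq_bigr => i _; congr (_ * _).
  apply: eq_bigr => j _; rewrite /H1inner.
  by rewrite (is_derive_derive1 (fun x => dx1 t x (oc t tT))).
have [K0 K00 hK0] := joint_continuous_bounded L0 T0 j10.
have [K1 K10 hK1] := joint_continuous_bounded L0 T0 j11.
have cc j : {within `[0, T], continuous (c j)}.
  have h0 := L2inner_time_continuous T0 (joint_continuous_time j00) dt0 (joint_continuous_space j00) (ce j)
    (fun t x tT => hK0 t x (oc t tT)).
  have h1 := L2inner_time_continuous T0 (joint_continuous_time j01) dt1 (joint_continuous_space j01) (ce' j)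
    (fun t x tT => hK1 t x (oc t tT)).
  by move=> t; apply: cvgD; [exact: h0|exact: h1].
have dc j (t : R) : 0 < t < T -> is_derive t 1 (c j) (c1 j t).
  move=> tT.
  have ? := is_derive_int dt0 (fun t tT => joint_continuous_space j00 (oc t tT)) (ce j)
    (fun t x tT => hK0 t x (oc t tT)) tT.
  have ? := is_derive_int dt1 (fun t tT => joint_continuous_space j01 (oc t tT)) (ce' j)
    (fun t x tT => hK1 t x (oc t tT)) tT.
  exact: is_deriveD.
exists w, wt; split.
- by move=> t; split; apply: spans_sum => //; exact: fe_spans SF.
- by move=> t v tT Sv; rewrite wE//; apply: eP => //; exact: C00.
- by move=> t v tT Sv; rewrite wtE//; apply: eP => //; exact: C10.
- by move=> x; apply: within_dot_cst => i; exact: within_dot_cst.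
- move=> t x tT; apply: is_derive_dot_cst => i; apply: is_derive_dot_cst => j.
  exact: dc.
Qed.

End DiscreteError.

(** * The error bound *)

Section ErrorBound.
Context {R : realType}.
Implicit Types (L T : R).

(** With Y = ||theta(0)|| <= 2 Q, the factor of A is at most 4 Q^2 + Q^2, the origin of the 5. *)
Lemma energy_to_norm (X Y Q A : R) : 0 <= X -> 0 <= Y -> 0 <= Q -> 0 <= A ->
  X ^+ 2 + Q ^+ 2 <= A * (Y ^+ 2 + Q ^+ 2) -> Y <= Q + Q -> X <= Num.sqrt (5 * A) * Q.
Proof.
move=> X0 Y0 Q0 A0 h YQ.
rewrite -(ger0_norm Q0) -sqrtr_sqr -sqrtrM ?mulr_ge0// -(ger0_norm X0) -sqrtr_sqr ler_wsqrtr//.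
have Y2 : Y ^+ 2 <= 4 * Q ^+ 2.
  have -> : 4 * Q ^+ 2 = (Q + Q) ^+ 2 by ring.
  by apply: lerXn2r => //; rewrite nnegrE addr_ge0.
have h2 : A * (Y ^+ 2 + Q ^+ 2) <= A * (4 * Q ^+ 2 + Q ^+ 2) by rewrite ler_wpM2l// lerD2r.
have Q2 := sqr_ge0 Q.
have -> : 5 * A * Q ^+ 2 = A * (4 * Q ^+ 2 + Q ^+ 2) by ring.
lra.
Qed.

Lemma isolate_first (a b c d : R) : a + - b + c - d = 0 -> a = b - c + d.
Proof. lra. Qed.

Lemma L2nrm_distC L (f g : R -> R) : L2nrm L (fun x => f x - g x) = L2nrm L (fun x => g x - f x).
Proof. by congr Num.sqrt; apply: eq_Rintegral => x _; rewrite -sqrrN opprB. Qed.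

(** [Q] bounds the projection errors and the initial error together. The projection hypotheses range
    over every [w] satisfying the orthogonality relation because the projection is constructed only
    inside the proof. [C] depends on [L], [T] and [M] alone. *)
Lemma discrete_error L T (M : R) : 0 < L -> 0 < T -> 0 <= M -> exists2 C : R, 0 < C &
  forall r (S : fe_space R) (D00 D01 D10 D11 : R -> R -> R) uh0 uh (Q : R),
  let jcont D := {within `[0, T] `*` [set: R], continuous (fun p : R * R => D p.1 p.2)} in
  is_fe_space L r S ->
  [/\ jcont D00, jcont D01, jcont D10 & jcont D11] ->
  (forall t x : R, 0 < t < T -> is_derive t 1 (D00 ^~ x) (D10 t x)) ->
  (forall t x : R, 0 < t < T -> is_derive t 1 (D01 ^~ x) (D11 t x)) ->
  (forall t x : R, 0 <= t <= T -> is_derive x 1 (D00 t) (D01 t x)) ->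
  (forall t x : R, 0 <= t <= T -> is_derive x 1 (D10 t) (D11 t x)) ->
  (forall t, 0 <= t <= T -> C1per L (D00 t)) ->
  (forall t, 0 < t < T -> C1per L (D10 t)) ->
  (forall t v, 0 < t < T -> C1per L v ->
    L2inner L (D10 t) v = L2inner L (flux L (D00 t)) (derive1 v)) ->
  (forall t x, 0 <= t <= T -> `|D00 t x| <= M) ->
  (forall t w, 0 <= t <= T -> fe_fun S w ->
    (forall v, fe_fun S v -> H1inner L (fun x => D00 t x - w x) v = 0) ->
    [/\ L2nrm L (fun x => D00 t x - w x) <= Q,
        L2nrm L (derive1 (fun x => D00 t x - w x)) <= Q & forall x, `|w x| <= M]) ->
  (forall t w, 0 < t < T -> fe_fun S w ->
    (forall v, fe_fun S v -> H1inner L (fun x => D10 t x - w x) v = 0) ->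
    L2nrm L (fun x => D10 t x - w x) <= Q) ->
  0 <= Q -> is_semidiscrete L T S uh0 uh ->
  L2nrm L (fun x => D00 0 x - uh 0 x) <= Q ->
  forall t, 0 <= t <= T -> L2nrm L (fun x => D00 t x - uh t x) <= C * Q.
Proof.
move=> L0 T0 M0; have [C C0 hC] := energy_estimate L0 M0.
(* The 1 accounts for rho, the square root for theta. *)
exists (1 + Num.sqrt (5 * expR (C * T))); first by rewrite ltr_wpDr ?sqrtr_ge0.
move=> r S D00 D01 D10 D11 uh0 uh Q jcont SF jc dt0 dt1 dx0 dx1 C00 C10 weak supM hp0 hp1 Q0.
move=> [uhS uh00 uhc uhd uhE] hinit t tT.
have oc (s : R) : 0 < s < T -> 0 <= s <= T by move=> /andP[h1 h2]; rewrite !ltW.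
have [w [wt [wS w0 w1 wc wd]]] := projection_in_time L0 T0 SF jc dt0 dt1 dx0 dx1 C00 C10.
have SS := fe_spans SF.
have SC f : fe_fun S f -> C1per L f by exact: fe_C1per SF.
pose uht s x := derive1 (fun s' => uh s' x) s.
pose th s x := w s x - uh s x.
pose th1 s x := wt s x - uht s x.
have thS s : 0 <= s <= T -> fe_fun S (th s).
  by move=> sT; exact: (spans_sub SS (wS s).1 (uhS s sT)).
have thc x : {within `[0, T], continuous (th ^~ x)}.
  by move=> s; apply: cvgB; [exact: wc|exact: uhc].
have thd (s x : R) : 0 < s < T -> is_derive s 1 (th ^~ x) (th1 s x).
  move=> sT; have ? := wd s x sT.
  have ? : is_derive s 1 (fun s' => uh s' x) (uht s x).
    by rewrite /uht derive1E; apply/derivableP; exact: uhd.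
  exact: is_deriveB.
have [th1S Ec Ed] := square_norm_in_time L0 SF thS thc thd.
have Eb (s : R) : 0 < s < T -> 2 * L2inner L (th1 s) (th s) <= C * (L2nrm L (th s) ^+ 2 + Q ^+ 2).
  move=> sT; have sT' := oc s sT.
  have [r1 r2 wM] := hp0 s (w s) sT' (wS s).1 (fun v Sv => w0 s v sT' Sv).
  have cwt : continuous (wt s) by exact: C1per_continuous (SC _ (wS s).2).
  have cth1 : continuous (th1 s) by exact: C1per_continuous (SC _ (th1S s sT)).
  have cuht : continuous (uht s).
    have -> : uht s = (fun x => wt s x - th1 s x) by apply/funext => x; rewrite /th1 subKr.
    exact: contB.
  apply: (hC (fe_fun S) (D00 s) (D10 s) (w s) (wt s) (uh s) (uht s) Q SS SC (C00 s sT')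
    (wS s).1 (uhS s sT') (C1per_continuous (C10 s sT)) cwt cuht _ _ _ wM Q0 r1 r2 _).
  - by move=> v Sv; exact: weak sT (SC _ Sv).
  - move=> v Sv; have Cv := SC _ Sv; have Cu := SC _ (uhS s sT').
    have [_ cv' _] := Cv.
    have := uhE s sT v Sv; rewrite (L2inner_flux Cu cv') (weak_burgers L0 Cu Cv) -/(uht s).
    exact: isolate_first.
  - by move=> x; exact: supM.
  - exact: hp1 sT (wS s).2 (fun v Sv => w1 s v sT Sv).
have G := gronwall C0 Ec Ed Eb tT.
have T00 : 0 <= (0 : R) <= T by apply/andP; split; [exact: lexx|exact: ltW].
have [q1 _ _] := hp0 0 (w 0) T00 (wS 0).1 (fun v Sv => w0 0 v T00 Sv).
have [p1 _ _] := hp0 t (w t) tT (wS t).1 (fun v Sv => w0 t v tT Sv).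
have cD s : 0 <= s <= T -> continuous (D00 s) by move=> sT; exact: C1per_continuous (C00 s sT).
have cw s : continuous (w s) by exact: C1per_continuous (SC _ (wS s).1).
have cuh s : 0 <= s <= T -> continuous (uh s).
  by move=> sT; exact: C1per_continuous (SC _ (uhS s sT)).
have th0 : L2nrm L (th 0) <= Q + Q.
  have -> : th 0 = (fun x => (D00 0 x - uh 0 x) - (D00 0 x - w 0 x)).
    by apply/funext => x; rewrite /th opprB [RHS]addrC addrA subrK.
  apply: le_trans (L2nrmB _ _ _) (lerD hinit q1); apply: contB => //; [exact: cD|exact: cuh|exact: cD].
have tht : L2nrm L (th t) <= Num.sqrt (5 * expR (C * T)) * Q.
  apply: (energy_to_norm (L2nrm_ge0 L (th t)) (L2nrm_ge0 L (th 0)) Q0 (expR_ge0 (C * T)) _ th0).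
  apply: le_trans G _; rewrite ler_wpM2r ?addr_ge0 ?sqr_ge0// ler_expR.
  by apply: ler_wpM2l; [exact: ltW|case/andP: tT].
have -> : (fun x => D00 t x - uh t x) = (fun x => (D00 t x - w t x) + th t x).
  by apply/funext => x; rewrite /th addrA subrK.
rewrite mulrDl mul1r; apply: le_trans (L2nrmD _ _ _) (lerD p1 tht).
- by apply: contB => //; exact: cD.
- exact: C1per_continuous (SC _ (thS t tT)).
Qed.

End ErrorBound.

(** * Weak form of the smooth solution, mesh-independent bounds, and conclusion *)

Section SmoothSolution.
Context {R : realType}.
Implicit Types (L T : R).

Lemma uniform_bound (n : nat) (A : Type) (Q : A -> Prop) (f : nat -> A -> R) :
  (forall j, (j <= n)%N -> exists2 K : R, 0 <= K & forall a, Q a -> f j a <= K) ->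
  exists2 K : R, 0 <= K & forall j a, (j <= n)%N -> Q a -> f j a <= K.
Proof.
elim: n => [|n IH] h.
  have [K K0 hK] := h 0%N isT; exists K => // j a; rewrite leqn0 => /eqP ->; exact: hK.
have [K K0 hK] := IH (fun j jn => h j (leqW jn)); have [K' K'0 hK'] := h n.+1 (leqnn _).
exists (K + K'); first exact: addr_ge0.
move=> j a; rewrite leq_eqVlt => /predU1P[->|jn] Qa.
  by rewrite (le_trans (hK' a Qa))// lerDr.
by rewrite (le_trans (hK j a jn Qa))// lerDl.
Qed.

(** The equation identifies the derivative of the flux with [- g], which is continuous; thus the
    flux is periodic C1 and integration by parts applies. *)
Lemma strong_to_weak L (f g v : R -> R) : 0 < L -> C1per L f -> continuous g -> C1per L v ->
  (forall x : R, derivable (flux L f) x 1) -> (forall x, g x + derive1 (flux L f) x = 0) ->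
  L2inner L g v = L2inner L (flux L f) (derive1 v).
Proof.
move=> L0 Cf cg Cv df e.
have dE : derive1 (flux L f) = (fun x => -1 * g x).
  by apply/funext => x; have := e x => /eqP; rewrite addr_eq0 => /eqP ->; rewrite mulN1r opprK.
have CF : C1per L (flux L f).
  by split; [exact: df|rewrite dE; exact: contZ|exact: flux_periodic].
have := parts_periodic L0 CF Cv; rewrite dE (L2innerZl L (-1) cg (C1per_continuous Cv)) mulN1r.
exact: oppr_inj.
Qed.

(** Comparison with chi = 0 bounds u - w and its derivative by 2 M1 in L2, hence w and w_x by 3 M1;
    interpolation with weight 1 gives a sup bound independent of the mesh. *)
Lemma projection_sup L (S : set (R -> R)) (u w : R -> R) (M1 Cs : R) : spans S ->
  (forall f, S f -> C1per L f) -> C1per L u -> S w ->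
  (forall v, S v -> H1inner L (fun x => u x - w x) v = 0) ->
  0 <= Cs -> L2nrm L u <= M1 -> L2nrm L (derive1 u) <= M1 ->
  (forall f x, C1per L f -> `|f x| <= 1 * L2nrm L (derive1 f) + Cs * L2nrm L f) ->
  forall x, `|w x| <= 3 * M1 + Cs * (3 * M1).
Proof.
move=> SS SC Cu Sw orth Cs0 uM uM' sup x; have Cw := SC _ Sw.
have S0 : S (fun=> 0) by case: SS.
have := best_approximation SS SC Cu Sw S0 orth.
have -> : (fun x => u x - 0) = u by apply/funext => y; rewrite subr0.
have uM2 : L2nrm L u + L2nrm L (derive1 u) <= 2 * M1 by rewrite mulr_natl mulr2n lerD.
move=> /sqr_sum_le => /(_ (2 * M1) (L2nrm_ge0 _ _) (L2nrm_ge0 _ _) (L2nrm_ge0 _ _) (L2nrm_ge0 _ _) uM2).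
have [cu cw] := (C1per_continuous Cu, C1per_continuous Cw).
have [[_ cu' _] [_ cw' _]] := (Cu, Cw).
rewrite (C1perB Cu Cw).2 => -[h1 h2].
have e (f g : R -> R) : g = (fun x => f x - (f x - g x)) by apply/funext => y; rewrite subKr.
have M3 : M1 + 2 * M1 = 3 * M1 by ring.
have n1 : L2nrm L w <= 3 * M1.
  by rewrite (e u w) -M3; apply: le_trans (L2nrmB L cu (contB cu cw)) (lerD uM h1).
have n2 : L2nrm L (derive1 w) <= 3 * M1.
  by rewrite (e (derive1 u) (derive1 w)) -M3; apply: le_trans (L2nrmB L cu' (contB cu' cw')) (lerD uM' h2).
by apply: le_trans (sup w x Cw) _; rewrite mul1r lerD// ler_wpM2l.
Qed.

End SmoothSolution.

Theorem theorem3p1 (R : realType) (r : nat) (hr : (2 <= r)%N) :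
  exists m : nat,
  forall (L T : R), 0 < L -> 0 < T ->
  forall (I : Type) (S : I -> fe_space R),
    (forall i, is_fe_space L r (S i)) ->
    approximation_property L r S ->
  forall (u0 : R -> R) (u : R -> R -> R),
    periodic u0 (2 * L) ->
    is_solution L T u0 u ->
    smooth_upto m T u ->
  forall C0 : R,
  exists2 C : R, 0 < C &
    forall (i : I) (uh0 : R -> R) (uh : R -> R -> R),
      fe_fun (S i) uh0 ->
      (L2norm L (uh0 \- u0)%R <= (C0 * mesh (S i) ^+ r.-1)%:E)%E ->
      is_semidiscrete L T (S i) uh0 uh ->
      (ereal_sup [set L2norm L (u t \- uh t)%R | t in `[0%R, T]%classic]
       <= (C * mesh (S i) ^+ r.-1)%:E)%E.
Proof.
(* Both u and u_t enter the approximation estimate with r space derivatives, and each [D i j] with i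
   <= 1 and j <= r is differentiated once more in x; the orders reach r + 2. *)
exists (r + 3)%N => L T L0 T0 I S SF AP u0 u pu0 [sol0 solp sole] [D [Du Dc Dt Dx]] C0.
have r1 : (1 <= r)%N by exact: ltnW.
have oc (t : R) : 0 < t < T -> 0 <= t <= T by move=> /andP[h1 h2]; rewrite !ltW.
have ord_lt i j : (i <= 1)%N -> (j <= r)%N -> (i + j < r + 3)%N.
  by move=> i1 jr; rewrite (leq_ltn_trans (leq_add i1 jr))// addnC ltn_add2l.
have jc i j : (i <= 1)%N -> (j <= r)%N ->
    {within `[0, T] `*` [set: R], continuous (fun p : R * R => D i j p.1 p.2)}.
  by move=> i1 jr; apply: Dc; exact/ltnW/ord_lt.
have cD i j t : (i <= 1)%N -> (j <= r)%N -> 0 <= t <= T -> continuous (D i j t).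
  by move=> i1 jr; exact: joint_continuous_space (jc i j i1 jr) t.
have dxD i j (t x : R) : (i <= 1)%N -> (j <= r)%N -> 0 <= t <= T -> is_derive x 1 (D i j t) (D i j.+1 t x).
  by move=> i1 jr; exact: Dx (ord_lt i j i1 jr) t x.
have dtD j (t x : R) : (j <= r)%N -> 0 < t < T -> is_derive t 1 (fun s => D 0%N j s x) (D 1%N j t x).
  by move=> jr; exact: Dt (ord_lt 0%N j isT jr) t x.
have DE t : 0 <= t <= T -> D 0%N 0%N t = u t by move=> tT; apply/funext => x; exact: Du.
have p0 t : 0 <= t <= T -> periodic (D 0%N 0%N t) (2 * L) by move=> tT; rewrite DE//; exact: solp.
have utE (t x : R) : 0 < t < T -> derive1 (fun s => u s x) t = D 1%N 0%N t x.
  move=> tT; have d := dtD 0%N t x isT tT; rewrite derive1E -(@derive_val _ _ _ _ _ _ _ d).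
  (* [D 0 0] agrees with u on [0, T], which is a neighbourhood of any interior time. *)
  by apply: near_eq_derive; have := open_interval_near tT; apply: filterS => s sT; rewrite DE.
have p1 t : 0 < t < T -> periodic (D 1%N 0%N t) (2 * L).
  move=> tT x; rewrite -!utE// !derive1E; apply: near_eq_derive.
  by have := open_interval_near tT; apply: filterS => s sT; exact: solp.
have C00 t : 0 <= t <= T -> C1per L (D 0%N 0%N t).
  move=> tT; apply: (C1per_intro (fun x => dxD 0%N 0%N t x isT isT tT)); last exact: p0.
  exact: cD.
have C10 t : 0 < t < T -> C1per L (D 1%N 0%N t).
  move=> tT; apply: (C1per_intro (fun x => dxD 1%N 0%N t x isT isT (oc t tT))); last exact: p1.
  by apply: cD => //; exact: oc.
have weak t v : 0 < t < T -> C1per L v ->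
    L2inner L (D 1%N 0%N t) v = L2inner L (flux L (D 0%N 0%N t)) (derive1 v).
  move=> tT Cv; have tT' := oc t tT.
  apply: strong_to_weak L0 (C00 t tT') (C1per_continuous (C10 t tT)) Cv _ _; rewrite DE//.
    by move=> x; have [] := sole t x tT.
  by move=> x; have [_ _] := sole t x tT; rewrite utE.
have bd i : (i <= 1)%N -> exists2 K : R, 0 <= K &
    forall j t, (j <= r)%N -> 0 <= t <= T -> L2nrm L (D i j t) <= K.
  move=> i1; apply: (@uniform_bound R r R (fun t => 0 <= t <= T) (fun j t => L2nrm L (D i j t))) => j jr.
  have [K K0 hK] := joint_continuous_bounded L0 T0 (jc i j i1 jr).
  exists (Num.sqrt (2 * L) * K); first by rewrite mulr_ge0 ?sqrtr_ge0.
  move=> t tT; apply: L2nrm_le_sup => //; first exact: cD.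
  by move=> x xL; exact: hK.
have [B0 B00 hB0] := bd 0%N isT; have [B1 B10 hB1] := bd 1%N isT.
pose M1 := B0 + B1; have M10 : 0 <= M1 by exact: addr_ge0.
have hM0 j t : (j <= r)%N -> 0 <= t <= T -> L2nrm L (D 0%N j t) <= M1.
  by move=> jr tT; rewrite (le_trans (hB0 j t jr tT))// lerDl.
have hM1 j t : (j <= r)%N -> 0 <= t <= T -> L2nrm L (D 1%N j t) <= M1.
  by move=> jr tT; rewrite (le_trans (hB1 j t jr tT))// lerDr.
have [K K0 hK] := projection_error L0 r1 M10 SF AP.
have [Cs Cs0 hCs] := sup_interpolation L0 ltr01.
(* A common sup bound for u and its projections, with the value delivered by [projection_sup]. *)
pose M := 3 * M1 + Cs * (3 * M1).
have M0 : 0 <= M by rewrite addr_ge0// ?mulr_ge0// ltW.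
have [C Cp hC] := discrete_error L0 T0 M0.
(* [C0] may be negative, hence its absolute value; the sum makes [Q] dominate both the projection
   errors and the initial error. *)
exists (C * (K + `|C0|)); first by rewrite mulr_gt0// ltr_wpDr.
move=> i uh0 uh Suh0 h0 semi.
have Si := SF i; have SS := fe_spans Si.
have SC f : fe_fun (S i) f -> C1per L f by exact: fe_C1per Si.
have h1 := mesh_gt0 L0 Si; set h := mesh (S i) in h0 h1 *.
have hp : 0 <= h ^+ r.-1 by rewrite exprn_ge0// ltW.
pose Q := (K + `|C0|) * h ^+ r.-1.
have Q0 : 0 <= Q by rewrite mulr_ge0// addr_ge0// ltW.
have KQ : K * h ^+ r.-1 <= Q by rewrite ler_wpM2r// lerDl.
have [uhS uh00 _ _ _] := semi.
have cuh t : 0 <= t <= T -> continuous (uh t).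
  by move=> tT; exact: C1per_continuous (SC _ (uhS t tT)).
have T00 : 0 <= (0 : R) <= T by apply/andP; split; [exact: lexx|exact: ltW].
have hinit : L2nrm L (fun x => D 0%N 0%N 0 x - uh 0 x) <= Q.
  have uE : uh 0 = uh0 by apply/funext.
  have u0E : D 0%N 0%N 0 = u0 by apply/funext => x; rewrite DE.
  move: h0; rewrite L2nrm_distC -uE -u0E.
  rewrite (L2norm_continuous L (contB (cuh 0 T00) (cD 0%N 0%N 0 isT isT T00))).
  rewrite lee_fin => /le_trans; apply; rewrite ler_wpM2r// (le_trans (ler_norm _))//.
  by rewrite lerDr ltW.
apply: ge_ereal_sup => _ [t /= tT <-]; rewrite in_itv/= in tT.
rewrite -DE// (L2norm_continuous L (contB (cD 0%N 0%N t isT isT tT) (cuh t tT))).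
rewrite lee_fin -mulrA.
have hp0 s w : 0 <= s <= T -> fe_fun (S i) w ->
    (forall v, fe_fun (S i) v -> H1inner L (fun x => D 0%N 0%N s x - w x) v = 0) ->
    [/\ L2nrm L (fun x => D 0%N 0%N s x - w x) <= Q,
        L2nrm L (derive1 (fun x => D 0%N 0%N s x - w x)) <= Q & forall x, `|w x| <= M].
  move=> sT Sw orth.
  have [q1 q2] := hK i w (fun j => D 0%N j s) Sw (fun j jr => cD 0%N j s isT jr sT)
    (fun j jr x => dxD 0%N j s x isT (ltnW jr) sT) (p0 s sT) (fun j jr => hM0 j s jr sT) orth.
  split; [exact: le_trans q1 KQ|exact: le_trans q2 KQ|].
  apply: (projection_sup SS SC (C00 s sT) Sw orth (ltW Cs0) (hM0 0%N s isT sT) _ hCs).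
  by rewrite (is_derive_derive1 (fun x => dxD 0%N 0%N s x isT isT sT)); exact: hM0.
have hp1 s w : 0 < s < T -> fe_fun (S i) w ->
    (forall v, fe_fun (S i) v -> H1inner L (fun x => D 1%N 0%N s x - w x) v = 0) ->
    L2nrm L (fun x => D 1%N 0%N s x - w x) <= Q.
  move=> sT' Sw orth; have sT := oc s sT'.
  have [q1 _] := hK i w (fun j => D 1%N j s) Sw (fun j jr => cD 1%N j s isT jr sT)
    (fun j jr x => dxD 1%N j s x isT (ltnW jr) sT) (p1 s sT') (fun j jr => hM1 j s jr sT) orth.
  exact: le_trans q1 KQ.
have jcs := And4 (jc 0%N 0%N isT isT) (jc 0%N 1%N isT r1) (jc 1%N 0%N isT isT) (jc 1%N 1%N isT r1).
have supM s x : 0 <= s <= T -> `|D 0%N 0%N s x| <= M.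
  move=> sT; apply: le_trans (hCs _ x (C00 s sT)) _.
  rewrite (is_derive_derive1 (fun x => dxD 0%N 0%N s x isT isT sT)) mul1r.
  have M13 : M1 <= 3 * M1 by rewrite ler_peMl// ler1n.
  apply: lerD; first exact: le_trans (hM0 1%N s r1 sT) M13.
  by rewrite ler_pM2l// (le_trans (hM0 0%N s isT sT)).
exact: (hC r (S i) (D 0%N 0%N) (D 0%N 1%N) (D 1%N 0%N) (D 1%N 1%N) uh0 uh Q Si jcs
  (fun t x tT => dtD 0%N t x isT tT) (fun t x tT => dtD 1%N t x r1 tT)
  (fun t x tT => dxD 0%N 0%N t x isT isT tT) (fun t x tT => dxD 1%N 0%N t x isT isT tT)
  C00 C10 weak supM hp0 hp1 Q0 semi hinit t tT).
Qed.
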